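(* Let $\beta,\gamma>0$, and for $h>0$ let $\mathbb{V}_{\mathrm{te}}(h)$ and $\mathbb{V}_{\mathrm{sk}}(h)$ be the asymptotic normalised variances of the one-step coupled level differences (defined in the context) of the tamed Euler and skew-symmetric schemes for the stochastic Ginzburg–Landau equation $\mathrm{d}X_t=(-X_t^3+\beta X_t)\,\mathrm{d}t+\gamma X_t\,\mathrm{d}W_t$. Then $$\mathbb{V}_{\mathrm{sk}}(h)<\mathbb{V}_{\mathrm{te}}(h)\quad\text{for }h>h_\star,\qquad \mathbb{V}_{\mathrm{sk}}(h)>\mathbb{V}_{\mathrm{te}}(h)\quad\text{for }0<h<h_\star,$$ where $$h_\star=\frac{2a_\star^2}{\gamma^2}\approx\frac{0.82}{\gamma^2},$$ $$a_\star:=\frac{\pi^2}{4}\left(\frac{-4-\pi+4\sqrt2}{\pi^{3/2}}+\sqrt{\left(\frac{-4-\pi+4\sqrt2}{\pi^{3/2}}\right)^2+\frac{4\bigl(2-16/\pi+8\sqrt2/\pi\bigr)}{\pi^2}}\right)\approx0.64$$ (the decimal values being rounded to two digits).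
   Context: Let $b(y)=-y^3+\beta y$. Let $U_1,U_2,V_1,V_2,G_1,G_2$ be independent standard Gaussian random variables and $$U_c=\frac{U_1+U_2}{\sqrt2},\quad V_c=\frac{V_1+V_2}{\sqrt2},\quad G_c=\frac{G_1+G_2}{\sqrt2}.$$ Tamed Euler: for $\eta>0$, $T_\eta(y;G):=y+\frac{\eta b(y)}{1+\eta|b(y)|}+\gamma y\sqrt\eta\,G$. Coarse and fine updates: $$Y_h^c(x):=T_h(x;G_c),\qquad Y_{h/2}^f(x):=T_{h/2}\bigl(T_{h/2}(x;G_1);G_2\bigr).$$ Skew-symmetric: for $\eta>0$, let $\tilde\alpha(\eta,y):=\sqrt{\frac{\pi}{2}}\sqrt\eta\,\frac{b(y)}{\gamma y}$ (with $b(y)/y=\beta-y^2$, also at $y=0$), $\beta_\eta(y):=\frac1{\sqrt{1+\tilde\alpha(\eta,y)^2}}$, $\delta_\eta(y):=\frac{\tilde\alpha(\eta,y)}{\sqrt{1+\tilde\alpha(\eta,y)^2}}$, and $$S_\eta(y;U,V):=y+\gamma y\sqrt\eta\bigl(\beta_\eta(y)V+\delta_\eta(y)|U|\bigr).$$ Coarse and fine updates: $$\tilde X_h^c(x):=S_h(x;U_c,V_c),\qquad \tilde X_{h/2}^f(x):=S_{h/2}\bigl(S_{h/2}(x;U_1,V_1);U_2,V_2\bigr).$$ The asymptotic normalised variances are the (existing, finite) limits $$\mathbb{V}_{\mathrm{te}}(h):=\lim_{x\to\infty}\frac1{x^2}\mathrm{Var}\bigl(Y_{h/2}^f(x)-Y_h^c(x)\bigr),\qquad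 \mathbb{V}_{\mathrm{sk}}(h):=\lim_{x\to\infty}\frac1{x^2}\mathrm{Var}\bigl(\tilde X_{h/2}^f(x)-\tilde X_h^c(x)\bigr).$$ *)

(* Defs.v *)
From HB Require Import structures.
From mathcomp Require Import all_boot all_order all_algebra.
From mathcomp Require Import all_classical all_reals all_analysis.

Set Implicit Arguments.
Unset Strict Implicit.
Unset Printing Implicit Defensive.

Import Order.TTheory GRing.Theory Num.Theory.
Import numFieldNormedType.Exports.

Local Open Scope classical_set_scope.
Local Open Scope ring_scope.

Definition standard_gaussian (d : measure_display) (T : measurableType d)
    (R : realType) (P : probability T R) (X : {RV P >-> R}) : Prop :=
  forall A : set R, measurable A -> distribution P X A = normal_prob 0 1 A.

Definition mutually_independent (d : measure_display) (T : measurableType d)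
    (R : realType) (P : probability T R) (I : finType)
    (X : I -> {RV P >-> R}) : Prop :=
  forall (J : {set I}) (B : I -> set R),
    (forall i, i \in J -> measurable (B i)) ->
    P (\bigcap_(i in [set` J]) (X i @^-1` B i)) =
    (\prod_(i in J) P (X i @^-1` B i))%E.

Section Schemes.
Variables (R : realType) (beta gamma : R).

Definition drift (y : R) : R := - y ^+ 3 + beta * y.

(* drift y / y, extended by its limit beta at y = 0 *)
Definition drift_ratio (y : R) : R := beta - y ^+ 2.

Definition tamed_step (eta y g : R) : R :=
  y + eta * drift y / (1 + eta * `|drift y|) + gamma * y * Num.sqrt eta * g.

Definition skew_alpha (eta y : R) : R :=
  Num.sqrt (pi / 2) * Num.sqrt eta * (drift_ratio y / gamma).

Definition skew_beta (eta y : R) : R :=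
  1 / Num.sqrt (1 + skew_alpha eta y ^+ 2).

Definition skew_delta (eta y : R) : R :=
  skew_alpha eta y / Num.sqrt (1 + skew_alpha eta y ^+ 2).

Definition skew_step (eta y u v : R) : R :=
  y + gamma * y * Num.sqrt eta * (skew_beta eta y * v + skew_delta eta y * `|u|).

Definition coarse_noise (z1 z2 : R) : R := (z1 + z2) / Num.sqrt 2.

Definition tamed_coarse (h x g1 g2 : R) : R :=
  tamed_step h x (coarse_noise g1 g2).

Definition tamed_fine (h x g1 g2 : R) : R :=
  tamed_step (h / 2) (tamed_step (h / 2) x g1) g2.

Definition skew_coarse (h x u1 u2 v1 v2 : R) : R :=
  skew_step h x (coarse_noise u1 u2) (coarse_noise v1 v2).

Definition skew_fine (h x u1 u2 v1 v2 : R) : R :=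
  skew_step (h / 2) (skew_step (h / 2) x u1 v1) u2 v2.

Variables (d : measure_display) (T : measurableType d) (P : probability T R).

Definition tamed_normalised_variance (G1 G2 : T -> R) (h x : R) : \bar R :=
  ((1 / x ^+ 2)%:E *
   variance P (fun w => tamed_fine h x (G1 w) (G2 w)
                        - tamed_coarse h x (G1 w) (G2 w))%R)%E.

Definition skew_normalised_variance (U1 U2 V1 V2 : T -> R) (h x : R) : \bar R :=
  ((1 / x ^+ 2)%:E *
   variance P (fun w => skew_fine h x (U1 w) (U2 w) (V1 w) (V2 w)
                        - skew_coarse h x (U1 w) (U2 w) (V1 w) (V2 w))%R)%E.

(* [lim] is total, so the two values below are meaningful only together with
   the convergence of the function under the limit. *)
Definition Vte (G1 G2 : T -> R) (h : R) : \bar R :=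
  lim (tamed_normalised_variance G1 G2 h x @[x --> +oo]).

Definition Vsk (U1 U2 V1 V2 : T -> R) (h : R) : \bar R :=
  lim (skew_normalised_variance U1 U2 V1 V2 h x @[x --> +oo]).

End Schemes.

Definition a_star (R : realType) : R :=
  let c : R := (- 4 - pi + 4 * Num.sqrt 2) / (pi `^ (3 / 2)) in
  pi ^+ 2 / 4 *
  (c + Num.sqrt (c ^+ 2 + 4 * (2 - 16 / pi + 8 * Num.sqrt 2 / pi) / pi ^+ 2)).

Definition h_star (R : realType) (gamma : R) : R :=
  2 * a_star R ^+ 2 / gamma ^+ 2.

(* Main.v *)
Require Import Defs.
From HB Require Import structures.
From mathcomp Require Import all_boot all_order all_algebra.
From mathcomp Require Import all_classical all_reals all_analysis.
From mathcomp Require Import measurable_realfun.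
From mathcomp Require Import ring lra.

Set Implicit Arguments.
Unset Strict Implicit.
Unset Printing Implicit Defensive.

Import Order.TTheory GRing.Theory Num.Theory.
Import numFieldNormedType.Exports.

Local Open Scope classical_set_scope.
Local Open Scope ring_scope.

(** Put a = gamma sqrt (h / 2). As the starting point x grows, both coupled
    differences become linear in x, up to an error that a square integrable
    variable dominates uniformly in x:
    - for the tamed scheme the drift increments are bounded by 1, so only the
      noise survives and the difference is x a^2 G1 G2;
    - for the skew-symmetric scheme the ratio of drift to noise is quadratic in
      the state, so the symmetric noise dies out and each step degenerates to
      y |-> y (1 - a |U|); the difference is x (a^2 |U1 U2| - a W) with
      W = |U1| + |U2| - |U1 + U2|.
    A variance is a quadratic form, so such an error does not affect the
    normalised limit (variance_rescaled_cvg) and the two limits are the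
    variances of a^2 G1 G2 and of a^2 |U1 U2| - a W.

    The first one is a^4. For the second one, W vanishes when U1 and U2 have
    the same sign and equals 2 min (|U1|, |U2|) otherwise. Reflecting U2 reduces
    every moment of W to an integral of min (s, t) over the quadrant, which
    elementary antiderivatives evaluate in terms of the Gaussian density and
    its tail (integral_sign_gap1, integral_sign_gap2, integral_sign_gap_prod).
    The outcome is that the two limits differ by a^2 q(a), where q is a
    quadratic polynomial (advantage) with roots of opposite signs; its positive
    root is a_star, and a > a_star amounts to h > h_star.

    The decimal values come from evaluating the sign of q on both sides of
    a_star, with the bounds 157/50 < pi < 22/7 that Taylor polynomials of the
    sine at pi / 6 provide. *)

(** * One-step differences for large states *)

Section Schemes.
Variable R : realType.
Implicit Types (beta gamma eta h x y g u v : R).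

(** Taming keeps the drift increment below 1 in modulus. *)
Lemma tamed_step_linear beta gamma eta y g : 0 < eta ->
  `|tamed_step beta gamma eta y g - y * (1 + gamma * Num.sqrt eta * g)| <= 1.
Proof.
move=> eta0; rewrite /tamed_step; set b := drift beta y.
have q0 : 0 < 1 + eta * `|b| by rewrite ltr_wpDr ?ltr01// mulr_ge0// ltW.
rewrite (_ : _ - _ = eta * b / (1 + eta * `|b|)); last by ring.
rewrite !normrM normrV ?unitfE ?gt_eqF// (gtr0_norm eta0) (gtr0_norm q0).
by rewrite ler_pdivrMr// mul1r lerDr ler01.
Qed.

Lemma sqrt_half_step h : 0 < h -> Num.sqrt h = Num.sqrt 2 * Num.sqrt (h / 2).
Proof. by move=> h0; rewrite -sqrtrM// mulrC divfK. Qed.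

(** Over a full step the coarse noise is the sum of the two fine ones. *)
Lemma sqrt_coarse_noise h u v : 0 < h ->
  Num.sqrt h * coarse_noise u v = Num.sqrt (h / 2) * (u + v).
Proof.
move=> h0; rewrite sqrt_half_step// /coarse_noise.
have s2 : Num.sqrt 2 != 0 :> R by rewrite gt_eqF// sqrtr_gt0.
by field.
Qed.

(** The three drift increments contribute a bounded error, except that the
    first fine one is also multiplied by the second fine noise. *)
Lemma tamed_difference_linear beta gamma h x g1 g2
    (a := gamma * Num.sqrt (h / 2)) : 0 < gamma -> 0 < h ->
  `|tamed_fine beta gamma h x g1 g2 - tamed_coarse beta gamma h x g1 g2
    - x * (a ^+ 2 * (g1 * g2))| <= (3 + a) * (1 + g1 ^+ 2 + g2 ^+ 2).
Proof.
move=> gamma0 h0.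
have a0 : 0 <= a by rewrite mulr_ge0// ltW.
have hh : 0 < h / 2 by rewrite divr_gt0.
rewrite /tamed_fine /tamed_coarse.
set y := tamed_step _ _ _ x g1.
have := tamed_step_linear beta gamma x g1 hh; rewrite -/y -/a => e1.
have := tamed_step_linear beta gamma y g2 hh; rewrite -/a.
set z := tamed_step _ _ _ y g2 => e2.
have := tamed_step_linear beta gamma x (coarse_noise g1 g2) h0.
rewrite -(mulrA gamma) sqrt_coarse_noise// (mulrA gamma) -/a.
set w := tamed_step _ _ _ x _ => e3.
set d1 := y - _ in e1; set d2 := z - _ in e2; set d3 := w - _ in e3.
have -> : z - w - x * (a ^+ 2 * (g1 * g2)) = d1 * (1 + a * g2) + d2 - d3.
  by rewrite /d1 /d2 /d3; ring.
have g2le : `|g2| <= 1 + g1 ^+ 2 + g2 ^+ 2.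
  rewrite -(real_normK (num_real g2)).
  have := sqr_ge0 g1; have := sqr_ge0 (`|g2| - 1); nra.
apply: (@le_trans _ _ (1 + a * `|g2| + 1 + 1)).
  rewrite (le_trans (ler_normB _ _))// lerD//.
  rewrite (le_trans (ler_normD _ _))// lerD//.
  rewrite normrM -[leRHS]mul1r ler_pM//.
  by rewrite (le_trans (ler_normD _ _))// normr1 normrM (ger0_norm a0).
have := ler_wpM2l a0 g2le; have := sqr_ge0 g1; have := sqr_ge0 g2; lra.
Qed.

(** The drift-to-noise ratio al is quadratic in y. For large |y| it is negative
    and the weights beta_eta and 1 + delta_eta are at most 1 / |al|, of order
    y^-2, which beats the factor y in front of them. *)
Lemma skew_weights_bounded beta gamma eta : 0 < beta -> 0 < gamma -> 0 < eta ->
  exists2 C : R, 0 < C &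
  forall y, `|y| * `|skew_beta beta gamma eta y| <= C /\
            `|y| * `|skew_delta beta gamma eta y + 1| <= C.
Proof.
move=> beta0 gamma0 eta0.
pose K : R := Num.sqrt (pi / 2) * Num.sqrt eta / gamma.
have K0 : 0 < K.
  by rewrite !mulr_gt0 ?invr_gt0// sqrtr_gt0// divr_gt0// pi_gt0.
exists (2 * (1 + 2 * beta + 2 / K)).
  have : 0 < 2 / K by rewrite divr_gt0.
  lra.
move=> y; rewrite /skew_beta /skew_delta.
have -> : skew_alpha beta gamma eta y = K * (beta - y ^+ 2).
  by rewrite /skew_alpha /drift_ratio /K; ring.
set al := K * _; set s := Num.sqrt _.
have s2 : s ^+ 2 = 1 + al ^+ 2 by rewrite sqr_sqrtr// addr_ge0// sqr_ge0.
have s0 : 0 <= s by rewrite sqrtr_ge0.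
have s1 : 1 <= s by have := sqr_ge0 al; nra.
have sal : `|al| <= s.
  rewrite -(ler_pXn2r (ltn0Sn 1)) ?nnegrE// s2 real_normK ?num_real// lerDr.
  exact: ler01.
have sp : 0 < s by lra.
have yC : `|y| <= (1 + 2 * beta + 2 / K) * s.
  have K2 : 0 < 2 / K by rewrite divr_gt0.
  have y2 : `|y| ^+ 2 = y ^+ 2 by rewrite real_normK ?num_real.
  have yy := normr_ge0 y.
  have [yb|yb] := leP (y ^+ 2) (1 + 2 * beta).
    apply: (@le_trans _ _ ((1 + 2 * beta + 2 / K) * 1)); last first.
      by rewrite ler_pM2l//; lra.
    nra.
  apply: (@le_trans _ _ (2 / K * s)); last by rewrite ler_pM2r//; lra.
  apply: (@le_trans _ _ (2 / K * `|al|)); last by rewrite ler_pM2l.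
  have -> : 2 / K * `|al| = 2 * (y ^+ 2 - beta).
    rewrite /al normrM (gtr0_norm K0) ler0_norm; last by lra.
    by have := lt0r_neq0 K0 => K1; field.
  nra.
have divs t : `|t| <= 2 -> `|y| * `|t / s| <= 2 * (1 + 2 * beta + 2 / K).
  move=> t2; rewrite normrM normrV ?unitfE ?gt_eqF// (gtr0_norm sp) mulrA.
  rewrite ler_pdivrMr// -mulrA (mulrC 2) ler_pM//.
split; first by apply: divs; rewrite normr1; lra.
have [al0|al0] := leP al 0.
  rewrite -[X in al / s + X](divff (lt0r_neq0 sp)) -mulrDl; apply: divs.
  (* for a nonpositive ratio, al + s = 1 / (s - al) *)
  have prod1 : (al + s) * (s - al) = 1.
    by transitivity (s ^+ 2 - al ^+ 2); [ring|rewrite s2; ring].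
  rewrite ger0_norm; first by nra.
  by move: sal; rewrite ler_norml => /andP[]; lra.
(* a positive ratio only occurs for bounded y *)
have alb : y ^+ 2 < beta by move: al0; rewrite /al pmulr_rgt0//; lra.
have y2 : `|y| ^+ 2 = y ^+ 2 by rewrite real_normK ?num_real.
have yy := normr_ge0 y.
have K2 : 0 < 2 / K by rewrite divr_gt0.
apply: (@le_trans _ _ (`|y| * 2)); last by nra.
rewrite ler_wpM2l// (le_trans (ler_normD _ _))// normr1 normrM.
rewrite normrV ?unitfE ?gt_eqF// (gtr0_norm sp).
have : `|al| / s <= 1 by rewrite ler_pdivrMr// mul1r.
lra.
Qed.

(** By the previous bounds the symmetric noise degenerates to a one-sided one,
    with an error that does not depend on the state at all; this uniformity is
    what makes the estimate usable at the random intermediate state of the fine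
    scheme. *)
Lemma skew_step_linear beta gamma eta : 0 < beta -> 0 < gamma -> 0 < eta ->
  exists2 C : R, 0 < C & forall y u v,
  `|skew_step beta gamma eta y u v - y * (1 - gamma * Num.sqrt eta * `|u|)|
    <= C * (`|u| + `|v|).
Proof.
move=> beta0 gamma0 eta0.
have [C C0 HC] := skew_weights_bounded beta0 gamma0 eta0.
have ge0 : 0 < gamma * Num.sqrt eta by rewrite mulr_gt0 ?sqrtr_gt0.
exists (gamma * Num.sqrt eta * C); first by rewrite mulr_gt0.
move=> y u v; rewrite /skew_step; have [Hb Hd] := HC y.
set b := skew_beta _ _ _ _ in Hb *; set d := skew_delta _ _ _ _ in Hd *.
move: b d Hb Hd => b d Hb Hd.
rewrite (_ : _ - _ = gamma * Num.sqrt eta *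
    (y * b * v + y * (d + 1) * `|u|)); last by ring.
rewrite normrM (gtr0_norm ge0) -[leRHS]mulrA ler_pM2l// [leRHS]mulrDr.
rewrite (le_trans (ler_normD _ _))// addrC lerD//.
  by rewrite !normrM normr_id ler_wpM2r.
by rewrite !normrM ler_wpM2r.
Qed.

Lemma skew_difference_linear beta gamma h (a := gamma * Num.sqrt (h / 2)) :
  0 < beta -> 0 < gamma -> 0 < h ->
  exists B : R, forall x u1 u2 v1 v2,
  `|skew_fine beta gamma h x u1 u2 v1 v2
    - skew_coarse beta gamma h x u1 u2 v1 v2
    - x * (a ^+ 2 * `|u1 * u2| - a * (`|u1| + `|u2| - `|u1 + u2|))|
  <= B * (1 + u1 ^+ 2 + u2 ^+ 2 + v1 ^+ 2 + v2 ^+ 2).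
Proof.
move=> beta0 gamma0 h0.
have hh : 0 < h / 2 by rewrite divr_gt0.
have a0 : 0 < a by rewrite mulr_gt0 ?sqrtr_gt0.
have [C C0 HC] := skew_step_linear beta0 gamma0 hh.
have [C' C'0 HC'] := skew_step_linear beta0 gamma0 h0.
exists (C * (4 + 4 * a) + C' * 4) => x u1 u2 v1 v2.
rewrite /skew_fine /skew_coarse.
have := HC x u1 v1; rewrite -/a; set y := skew_step _ _ _ x u1 v1 => e1.
have := HC y u2 v2; rewrite -/a; set z := skew_step _ _ _ y u2 v2 => e2.
have := HC' x (coarse_noise u1 u2) (coarse_noise v1 v2).
set w := skew_step _ _ _ x _ _.
have -> : gamma * Num.sqrt h * `|coarse_noise u1 u2| = a * `|u1 + u2|.
  rewrite -mulrA -[X in gamma * (X * _)]ger0_norm ?sqrtr_ge0// -normrM.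
  by rewrite sqrt_coarse_noise// normrM (ger0_norm (sqrtr_ge0 _)) mulrA.
move=> e3.
have coarse_le (s t : R) : `|coarse_noise s t| <= `|s| + `|t|.
  have s2 : 1 <= Num.sqrt 2 :> R.
    by rewrite -[leLHS]sqrtr1 ler_wsqrtr// ler1n.
  have s0 := lt_le_trans ltr01 s2.
  rewrite /coarse_noise normrM normrV ?unitfE ?gt_eqF// (gtr0_norm s0).
  rewrite ler_pdivrMr//.
  rewrite (le_trans (ler_normD _ _))// ler_peMr// addr_ge0//.
set S := 1 + _ + _ + _ + _.
have nle (t : R) : `|t| <= 1 + t ^+ 2.
  rewrite -(real_normK (num_real t)); 
  have := sqr_ge0 `|t|; have := sqr_ge0 (`|t| - 1); lra.
have [[[nu1 nu2] nv1] nv2] := (nle u1, nle u2, nle v1, nle v2).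
have [u10 u20] := (sqr_ge0 u1, sqr_ge0 u2).
have [v10 v20] := (sqr_ge0 v1, sqr_ge0 v2).
have mixed (s t r : R) : `|s| + `|t| <= 2 * S ->
    `|s| ^+ 2 <= S -> `|t| ^+ 2 <= S ->
    `|r| ^+ 2 <= S -> (`|s| + `|t|) * (1 + a * `|r|) <= (2 + 2 * a) * S.
  move=> stS sS tS rS.
  have st := sqr_ge0 (`|s| - `|r|); have tt := sqr_ge0 (`|t| - `|r|).
  have str : (`|s| + `|t|) * `|r| <= 2 * S by lra.
  have := ler_wpM2l (ltW a0) str; lra.
have [mu1 mu2 mv1 mv2] : [/\ `|u1| ^+ 2 <= S, `|u2| ^+ 2 <= S,
    `|v1| ^+ 2 <= S & `|v2| ^+ 2 <= S].
  by rewrite !real_normK ?num_real// /S; split; lra.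
have E1 : `|(y - x * (1 - a * `|u1|)) * (1 - a * `|u2|)| <=
    C * ((2 + 2 * a) * S).
  apply: (@le_trans _ _ (C * (`|u1| + `|v1|) * (1 + a * `|u2|))).
    rewrite normrM ler_pM// (le_trans (ler_normB _ _))// normr1.
    by rewrite lerD// normrM normr_id (gtr0_norm a0).
  by rewrite -mulrA ler_pM2l// mixed// /S; lra.
have E2 : `|z - y * (1 - a * `|u2|)| <= C * (2 * S).
  by rewrite (le_trans e2)// ler_pM2l// /S; lra.
have E3 : `|w - x * (1 - a * `|u1 + u2|)| <= C' * (4 * S).
  rewrite (le_trans e3)// ler_pM2l//.
  have := coarse_le u1 u2; have := coarse_le v1 v2; rewrite /S; lra.
set d1 := _ * _ in E1; set d2 := z - _ in E2; set d3 := w - _ in E3.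
have -> : z - w - x * (a ^+ 2 * `|u1 * u2|
    - a * (`|u1| + `|u2| - `|u1 + u2|)) = d1 + d2 - d3.
  by rewrite /d1 /d2 /d3 normrM; ring.
rewrite (le_trans (ler_normB _ _))//.
have := ler_normD d1 d2.
have : 0 <= C * a * S by rewrite !mulr_ge0// ?ltW// /S; lra.
lra.
Qed.

End Schemes.

(** * Rational bounds for pi *)

Section PiBounds.
Variable R : realType.
Implicit Types x y : R.

(** Comparison principle behind the alternating Taylor bounds. *)
Lemma le_of_derive_le (f g df dg : R -> R) :
  (forall x, is_derive x 1 f (df x)) -> (forall x, is_derive x 1 g (dg x)) ->
  f 0 = g 0 -> (forall x, 0 <= x -> df x <= dg x) ->
  forall x, 0 <= x -> f x <= g x.
Proof.
move=> hf hg fg0 dfg x x0.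
have hgf y : is_derive y 1 (g - f) (dg y - df y).
  by apply: is_deriveB.
suff : (g - f) 0 <= (g - f) x by rewrite !fctE fg0 subrr subr_ge0.
apply: (@ger0_derive1_ndecry _ _ 0) => //.
- move=> y; rewrite in_itv/= andbT => y0.
  by rewrite derive1E derive_val subr_ge0 dfg// ltW.
- apply: continuous_subspaceT => y.
  by apply/differentiable_continuous/derivable1_diffP; have [] := hgf y.
Qed.

Lemma sin_le_taylor1 x : 0 <= x -> sin x <= x.
Proof.
apply: (@le_of_derive_le _ _ cos (fun=> 1)); first by rewrite sin0.
by move=> *; exact: cos_le1.
Qed.

Lemma cos_ge_taylor2 x : 0 <= x -> 1 - x ^+ 2 / 2 <= cos x.
Proof.
apply: (@le_of_derive_le (fun x => 1 - x ^+ 2 / 2) cos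
  (fun x => - x) (fun x => - sin x)).
- by move=> y; apply: is_derive_eq; rewrite ?scaler0 /GRing.scale/=; lra.
- by rewrite cos0 !expr0n !mul0r ?subr0 ?addr0 ?subr0.
- by move=> y y0; rewrite lerN2 sin_le_taylor1.
Qed.

Lemma sin_ge_taylor3 x : 0 <= x -> x - x ^+ 3 / 6 <= sin x.
Proof.
apply: (@le_of_derive_le (fun x => x - x ^+ 3 / 6) sin (fun x => 1 - x ^+ 2 / 2) cos).
- by move=> y; apply: is_derive_eq; rewrite ?scaler0 /GRing.scale/=; lra.
- by rewrite sin0 !expr0n !mul0r ?subr0 ?addr0 ?subr0.
- exact: cos_ge_taylor2.
Qed.

Lemma cos_le_taylor4 x : 0 <= x -> cos x <= 1 - x ^+ 2 / 2 + x ^+ 4 / 24.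
Proof.
apply: (@le_of_derive_le cos (fun x => 1 - x ^+ 2 / 2 + x ^+ 4 / 24)
  (fun x => - sin x) (fun x => - (x - x ^+ 3 / 6))).
- by move=> y; apply: is_derive_eq; rewrite ?scaler0 /GRing.scale/=; lra.
- by rewrite cos0 !expr0n !mul0r ?subr0 ?addr0 ?subr0.
- by move=> y y0; rewrite lerN2 sin_ge_taylor3.
Qed.

Lemma sin_le_taylor5 x : 0 <= x -> sin x <= x - x ^+ 3 / 6 + x ^+ 5 / 120.
Proof.
apply: (@le_of_derive_le sin (fun x => x - x ^+ 3 / 6 + x ^+ 5 / 120)
  cos (fun x => 1 - x ^+ 2 / 2 + x ^+ 4 / 24)).
- by move=> y; apply: is_derive_eq; rewrite ?scaler0 /GRing.scale/=; lra.
- by rewrite sin0 !expr0n !mul0r ?subr0 ?addr0 ?subr0.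
- exact: cos_le_taylor4.
Qed.

(** The last coefficient is 1/24 instead of 1/720: the
    cruder bound is still sharp enough at pi / 6. *)
Lemma cos_ge_taylor6 x : 0 <= x ->
  1 - x ^+ 2 / 2 + x ^+ 4 / 24 - x ^+ 6 / 24 <= cos x.
Proof.
apply: (@le_of_derive_le (fun x => 1 - x ^+ 2 / 2 + x ^+ 4 / 24 - x ^+ 6 / 24)
  cos (fun x => - (x - x ^+ 3 / 6 + x ^+ 5 / 4)) (fun x => - sin x)).
- by move=> y; apply: is_derive_eq; rewrite ?scaler0 /GRing.scale/=; lra.
- by rewrite cos0 !expr0n !mul0r ?subr0 ?addr0 ?subr0.
- move=> y y0; rewrite lerN2 (le_trans (sin_le_taylor5 y0))// lerD2l.
  by rewrite ler_wpM2l ?exprn_ge0// lef_pV2 ?posrE ?ltr0n// ler_nat.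
Qed.

Lemma sin_ge_taylor7 x : 0 <= x ->
  x - x ^+ 3 / 6 + x ^+ 5 / 120 - x ^+ 7 / 168 <= sin x.
Proof.
apply: (@le_of_derive_le (fun x => x - x ^+ 3 / 6 + x ^+ 5 / 120 - x ^+ 7 / 168)
  sin (fun x => 1 - x ^+ 2 / 2 + x ^+ 4 / 24 - x ^+ 6 / 24) cos).
- by move=> y; apply: is_derive_eq; rewrite ?scaler0 /GRing.scale/=; lra.
- by rewrite sin0 !expr0n !mul0r ?subr0 ?addr0 ?subr0.
- exact: cos_ge_taylor6.
Qed.

(** The triple-angle formula at pi / 6 reads (2 s - 1)^2 (s + 1) = 0. *)
Lemma sin_pi6 : sin (pi / 6) = 2^-1 :> R.
Proof.
set s := sin _.
have p0 : 0 < pi :> R by exact: pi_gt0.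
have s0 : 0 < s by apply: sin_gt0_pihalf; apply/andP; split; lra.
have : sin (pi / 6 + pi / 6 + pi / 6) = 1 :> R.
  by rewrite -[RHS]sin_pihalf; congr sin; lra.
rewrite sinD sinD cosD -/s; set c := cos _ => e.
have cs : c ^+ 2 + s ^+ 2 = 1 by rewrite /c /s cos2Dsin2.
have : (2 * s - 1) ^+ 2 * (s + 1) = 0.
  have -> : (2 * s - 1) ^+ 2 * (s + 1) = 1 - 3 * s * (c ^+ 2 + s ^+ 2)
     + 4 * s ^+ 3 + 3 * s * (c ^+ 2 + s ^+ 2 - 1) by ring.
  have c2 : c ^+ 2 = 1 - s ^+ 2 by lra.
  have : s * c ^+ 2 + c ^+ 2 * s + (c ^+ 2 * s - s ^+ 3) = 1 by lra.
  rewrite c2; lra.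
move/eqP; rewrite mulf_eq0 expf_eq0/= => /orP[/eqP|/eqP]; lra.
Qed.

Lemma pi_bounds : 157 / 50 < (pi : R) < 22 / 7.
Proof.
have p0 : 0 < pi :> R by exact: pi_gt0.
have p2 : 2 <= pi :> R by exact: pi_ge2.
have dom x : 0 <= x <= 1 -> x \in `[- (pi / 2), pi / 2]%R.
  by move=> x01; rewrite in_itv/=; lra.
have dom6 : (pi / 6 : R) \in `[- (pi / 2), pi / 2]%R.
  by rewrite in_itv/=; lra.
apply/andP; split.
- suff : (157 / 300 : R) < pi / 6 by lra.
  rewrite -ltr_sin//; last by apply: dom; lra.
  rewrite sin_pi6 (le_lt_trans (sin_le_taylor5 _))//; lra.
- suff : pi / 6 < (11 / 21 : R) by lra.
  rewrite -ltr_sin//; last by apply: dom; lra.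
  rewrite sin_pi6 (lt_le_trans _ (sin_ge_taylor7 _))//; lra.
Qed.

End PiBounds.

(** * The threshold a_star *)

Section Threshold.
Variable R : realType.
Implicit Types a t : R.

(** Minus the covariance of W and |U1 U2|. *)
Definition cross_coef : R := (- 4 - pi + 4 * Num.sqrt 2) / (pi `^ (3 / 2)).

(** The variance of W. *)
Definition square_coef : R := 2 - 16 / pi + 8 * Num.sqrt 2 / pi.

(** With a = t, the difference between the limit for the tamed scheme and the
    limit for the skew-symmetric one, divided by a^2. *)
Definition advantage t : R := 4 / pi ^+ 2 * t ^+ 2 - 2 * cross_coef * t - square_coef.

Lemma sqrt2_bounds : 707 / 500 < (Num.sqrt 2 : R) < 99 / 70.
Proof.
have s0 : 0 <= Num.sqrt 2 :> R by exact: sqrtr_ge0.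
have s2 : Num.sqrt 2 ^+ 2 = 2 :> R by rewrite sqr_sqrtr.
apply/andP; split; nra.
Qed.

Lemma sqrt_pi_bounds :
  443 / 250 < (Num.sqrt pi : R) < 55 / 31.
Proof.
have s0 : 0 <= Num.sqrt pi :> R by exact: sqrtr_ge0.
have s2 : Num.sqrt pi ^+ 2 = pi :> R by rewrite sqr_sqrtr// pi_ge0.
have /andP[] := pi_bounds R => ? ?; apply/andP; split; nra.
Qed.

Lemma pi_powR32 : pi `^ (3 / 2) = pi * Num.sqrt pi :> R.
Proof.
have -> : (3 / 2 : R) = 1 + 2^-1 by lra.
rewrite powRD; last by rewrite (gt_eqF (pi_gt0 R)) implybT.
by rewrite powRr1 ?pi_ge0// powR12_sqrt// pi_ge0.
Qed.

Lemma square_coef_gt0 : 0 < square_coef.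
Proof.
have /andP[s2l _] := sqrt2_bounds; have /andP[pl _] := pi_bounds R.
have -> : square_coef = (2 * pi - 16 + 8 * Num.sqrt 2) / pi.
  rewrite /square_coef; move: (lt0r_neq0 (pi_gt0 R)).
  by generalize (pi : R) => p p0; field.
rewrite divr_gt0 ?pi_gt0//; lra.
Qed.

(** The discriminant exceeds the square of the linear coefficient, because the
    constant term is negative; so the roots have opposite signs. *)
Lemma advantage_factor : exists2 b : R, b < 0 &
  0 < a_star R /\ forall t, advantage t = 4 / pi ^+ 2 * (t - a_star R) * (t - b).
Proof.
have p0 := pi_gt0 R; have p1 := lt0r_neq0 p0; have V0 := square_coef_gt0.
rewrite /a_star -/cross_coef -/square_coef.
set D := cross_coef ^+ 2 + _.
have DE : D = cross_coef ^+ 2 + 4 * square_coef / pi ^+ 2 by [].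
have w0 : 0 < 4 * square_coef / pi ^+ 2.
  by rewrite divr_gt0 ?exprn_gt0// mulr_gt0.
have D2 : Num.sqrt D ^+ 2 = D.
  by rewrite sqr_sqrtr// DE addr_ge0 ?sqr_ge0// ltW.
have cD : `|cross_coef| < Num.sqrt D.
  rewrite -(ltr_pXn2r (ltn0Sn 1)) ?nnegrE ?sqrtr_ge0// D2 real_normK ?num_real//.
  by rewrite DE ltrDl.
move: cD; rewrite ltr_norml => /andP[cD1 cD2].
have q0 : 0 < pi ^+ 2 / 4 :> R by rewrite divr_gt0// exprn_gt0.
exists (pi ^+ 2 / 4 * (cross_coef - Num.sqrt D)); first by rewrite pmulr_rlt0//; lra.
split; first by rewrite mulr_gt0//; lra.
move=> t; rewrite /advantage.
have -> : square_coef = pi ^+ 2 / 4 * (Num.sqrt D ^+ 2 - cross_coef ^+ 2).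
  rewrite D2 DE; move: square_coef cross_coef p1 => V c.
  by generalize (pi : R) => p p1; field.
move: (Num.sqrt D) cross_coef p1 => r c.
by generalize (pi : R) => p p1; field.
Qed.

Lemma a_star_gt0 : 0 < a_star R.
Proof. by have [? _ []] := advantage_factor. Qed.

Lemma advantage_gt0 t : 0 < t -> (0 < advantage t) = (a_star R < t).
Proof.
move=> t0; have [b b0 [_ ->]] := advantage_factor.
have tb : 0 < t - b by lra.
have w0 : 0 < 4 / pi ^+ 2 :> R by rewrite divr_gt0// exprn_gt0// pi_gt0.
by rewrite pmulr_lgt0// pmulr_rgt0// subr_gt0.
Qed.

Lemma advantage_lt0 t : 0 < t -> (advantage t < 0) = (t < a_star R).
Proof.
move=> t0; have [b b0 [_ ->]] := advantage_factor.
have tb : 0 < t - b by lra.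
have w0 : 0 < 4 / pi ^+ 2 :> R by rewrite divr_gt0// exprn_gt0// pi_gt0.
by rewrite pmulr_llt0// pmulr_rlt0// subr_lt0.
Qed.

(** Clearing denominators leaves a polynomial in pi, sqrt pi and sqrt 2. *)
Lemma advantage_scaled t : pi ^+ 2 * advantage t = 4 * t ^+ 2
  + 2 * t * (4 + pi - 4 * Num.sqrt 2) * Num.sqrt pi
  - 2 * pi ^+ 2 + (16 - 8 * Num.sqrt 2) * pi.
Proof.
have p1 := lt0r_neq0 (pi_gt0 R).
have s1 : Num.sqrt pi != 0 :> R by rewrite gt_eqF// sqrtr_gt0 pi_gt0.
have s2 : pi = Num.sqrt pi ^+ 2 :> R by rewrite sqr_sqrtr// pi_ge0.
rewrite /advantage /cross_coef /square_coef pi_powR32.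
move: s1 s2 p1; set s := Num.sqrt pi; move: s => s; generalize (Num.sqrt (2:R)).
by generalize (pi : R) => p r s1 -> p1; field.
Qed.

(** The scaled polynomial is decreasing in pi and in sqrt 2 and increasing in
    sqrt pi, so its sign is decided at a corner of the box of bounds. *)
Lemma advantage_corner (p r s : R) :
  157 / 50 < p < 22 / 7 -> 707 / 500 < r < 99 / 70 -> 443 / 250 < s < 55 / 31 ->
  let f t := 4 * t ^+ 2 + 2 * t * (4 + p - 4 * r) * s - 2 * p ^+ 2
             + (16 - 8 * r) * p in
  f (399 / 625) < 0 /\ 0 < f (61 / 95).
Proof.
move=> /andP[pl pu] /andP[rl ru] /andP[sl su] /=; split.
- have X : (4 + p - 4 * r) * s <= (4 + p - 4 * (707 / 500)) * (55 / 31).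
    by apply: ler_pM; lra.
  have Y : r * p >= 707 / 500 * p by rewrite ler_pM2r; lra.
  have Z := sqr_ge0 (p - 157 / 50); lra.
- have X : (4 + p - 4 * (99 / 70)) * (443 / 250) <= (4 + p - 4 * r) * s.
    by apply: ler_pM; lra.
  have Y : r * p <= 99 / 70 * p by rewrite ler_pM2r; lra.
  have Z : 0 < (22 / 7 - p) * (p - 3) by rewrite mulr_gt0; lra.
  lra.
Qed.

Lemma a_star_bounds : 399 / 625 < a_star R < 61 / 95.
Proof.
have p2 : 0 < pi ^+ 2 :> R by rewrite exprn_gt0// pi_gt0.
have [lo hi] := advantage_corner (pi_bounds R) sqrt2_bounds sqrt_pi_bounds.
rewrite -!advantage_scaled pmulr_rlt0// pmulr_rgt0// in lo hi.
have lo0 : 0 < 399 / 625 :> R by apply: divr_gt0; rewrite ltr0n.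
have hi0 : 0 < 61 / 95 :> R by apply: divr_gt0; rewrite ltr0n.
apply/andP; split.
- by rewrite (advantage_lt0 lo0) in lo.
- by rewrite (advantage_gt0 hi0) in hi.
Qed.

Lemma a_star_decimal : `|a_star R - 64 / 100| < 5 / 1000.
Proof. by have /andP[] := a_star_bounds; rewrite ltr_norml; lra. Qed.

Lemma h_star_decimal (gamma : R) : 0 < gamma ->
  `|h_star gamma - 82 / 100 / gamma ^+ 2| < 5 / 1000 / gamma ^+ 2.
Proof.
move=> gamma0; have g2 : 0 < gamma ^+ 2 by rewrite exprn_gt0.
rewrite /h_star -mulrBl normrM normrV ?unitfE ?gt_eqF// (gtr0_norm g2).
rewrite ltr_pM2r ?invr_gt0//.
by have /andP[] := a_star_bounds; rewrite ltr_norml => ? ?; apply/andP; nra.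
Qed.

Lemma h_star_lt (gamma h : R) (a := gamma * Num.sqrt (h / 2)) :
  0 < gamma -> 0 < h ->
  ((h_star gamma < h) = (a_star R < a)) * ((h < h_star gamma) = (a < a_star R)).
Proof.
move=> gamma0 h0; have g2 : 0 < gamma ^+ 2 by rewrite exprn_gt0.
have a0 : 0 <= a by rewrite mulr_ge0 ?sqrtr_ge0// ltW.
have a2 : a ^+ 2 = gamma ^+ 2 * (h / 2).
  by rewrite exprMn sqr_sqrtr// divr_ge0// ltW.
have as0 := ltW a_star_gt0.
rewrite /h_star ltr_pdivrMr// ltr_pdivlMr//.
have cmp : ((a_star R < a) = (a_star R ^+ 2 < a ^+ 2))
    * ((a < a_star R) = (a ^+ 2 < a_star R ^+ 2)).
  by rewrite !ltr_pXn2r.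
rewrite !cmp a2; split; first by apply/idP/idP; lra.
by apply/idP/idP; lra.
Qed.

End Threshold.

(** * Variances of asymptotically linear families *)

Section SquareIntegrable.
Context (d : measure_display) (T : measurableType d) (R : realType).
Variable P : probability T R.
Implicit Types f g L M : T -> R.

Lemma Lfun2_sqr f : measurable_fun setT f ->
  (\int[P]_w ((f w) ^+ 2)%:E < +oo)%E -> f \in Lfun P 2%:E.
Proof.
move=> mf f2; rewrite inE; apply/andP; split; rewrite inE/=; first exact: mf.
rewrite /finite_norm unlock poweR_lty//=.
by under eq_integral do rewrite powR_mulrn// real_normK ?num_real//.
Qed.

Lemma measurable_Lfun f (p : \bar R) : f \in Lfun P p -> measurable_fun setT f.
Proof. by rewrite inE => /andP[]; rewrite inE. Qed.

Lemma Lfun2_sqr_lty f : f \in Lfun P 2%:E -> (\int[P]_w ((f w) ^+ 2)%:E < +oo)%E.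
Proof.
move=> /Lfun2_integrable_sqr/integrableP[_]; apply: le_lt_trans.
by under [leRHS]eq_integral do rewrite /= ger0_norm ?sqr_ge0//.
Qed.

Lemma Lfun2_le f g : measurable_fun setT f -> (forall w, `|f w| <= g w) ->
  g \in Lfun P 2%:E -> f \in Lfun P 2%:E.
Proof.
move=> mf fg g2; apply: Lfun2_sqr => //; apply: le_lt_trans (Lfun2_sqr_lty g2).
apply: ge0_le_integral => //.
- by move=> w _; rewrite lee_fin sqr_ge0.
- by apply/measurable_EFinP; exact: measurable_funX.
- by apply/measurable_EFinP/measurable_funX; exact: measurable_Lfun g2.
- move=> w _; rewrite lee_fin -(real_normK (num_real (f w))).
  by rewrite ler_pXn2r// nnegrE// (le_trans _ (fg w)).
Qed.

Lemma Lfun2D f g : f \in Lfun P 2%:E -> g \in Lfun P 2%:E ->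
  (f \+ g)%R \in Lfun P 2%:E.
Proof. by move=> f2 g2; rewrite rpredD ?lee1n. Qed.

Lemma expectation_sqr f : expectation P (f ^+ 2) = (\int[P]_w ((f w) ^+ 2)%:E)%E.
Proof. by rewrite unlock; apply: eq_integral => w _; rewrite !expr2. Qed.

Lemma variance_le_sqr f : f \in Lfun P 2%:E ->
  (variance P f <= \int[P]_w ((f w) ^+ 2)%:E)%E.
Proof.
move=> f2; rewrite varianceE// expectation_sqr.
have f1 : f \in Lfun P 1 by rewrite Lfun_subset12 ?fin_num_measure.
rewrite -(fineK (expectation_fin_num f1)) -EFin_expe.
by rewrite leeBlDr// leeDl// lee_fin sqr_ge0.
Qed.

(** If D_x = x L + E_x with errors dominated in mean square, then
    Var D_x = x^2 Var L + 2 x Cov (L, E_x) + Var E_x, and both the covariance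
    and the last variance stay bounded. *)
Lemma variance_rescaled_cvg (D : R -> T -> R) L M :
  (forall x, measurable_fun setT (D x)) ->
  L \in Lfun P 2%:E -> M \in Lfun P 2%:E ->
  (forall x w, `|D x w - x * L w| <= M w) ->
  ((1 / x ^+ 2)%:E * variance P (D x))%E @[x --> +oo] --> variance P L.
Proof.
move=> mD L2 M2 DLM; pose E x w := D x w - x * L w.
have mL : measurable_fun setT L := measurable_Lfun L2.
have E2 x : E x \in Lfun P 2%:E.
  apply: (@Lfun2_le _ M) => //; last exact: DLM.
  by apply: measurable_funB => //; apply: measurable_funM.
have M0 w : 0 <= M w by rewrite (le_trans _ (DLM 0 w)).
pose K := fine (\int[P]_w ((M w) ^+ 2)%:E)%E.
have KE : (\int[P]_w ((M w) ^+ 2)%:E)%E = K%:E.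
  rewrite fineK// ge0_fin_numE ?Lfun2_sqr_lty// integral_ge0// => w _.
  by rewrite lee_fin sqr_ge0.
pose vL := fine (variance P L).
have vLE : variance P L = vL%:E by rewrite fineK// variance_fin_num.
pose vE x := fine (variance P (E x)).
have vEE x : variance P (E x) = (vE x)%:E by rewrite fineK// variance_fin_num.
pose c x := fine (covariance P L (E x)).
have cE x : covariance P L (E x) = (c x)%:E.
  by rewrite fineK// covariance_fin_num ?Lfun2_mul_Lfun1 ?Lfun_subset12
    ?fin_num_measure.
have vL0 : 0 <= vL by rewrite -lee_fin -vLE variance_ge0.
have vE0 x : 0 <= vE x by rewrite -lee_fin -vEE variance_ge0.
have vEK x : vE x <= K.
  rewrite -lee_fin -vEE -KE (le_trans (variance_le_sqr (E2 x)))//.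
  apply: ge0_le_integral => //.
  - by move=> w _; rewrite lee_fin sqr_ge0.
  - by apply/measurable_EFinP/measurable_funX; exact: measurable_Lfun (E2 x).
  - by apply/measurable_EFinP/measurable_funX; exact: measurable_Lfun M2.
  - move=> w _; rewrite lee_fin -(real_normK (num_real (E x w))).
    by rewrite ler_pXn2r// ?nnegrE ?M0// DLM.
have K0 : 0 <= K by rewrite (le_trans (vE0 0) (vEK 0)).
(* the variances of L + E x and of L - E x are nonnegative *)
have cK x : `|c x| <= (vL + K) / 2.
  have := variance_ge0 P (L \+ E x); have := variance_ge0 P (L \- E x).
  rewrite varianceB// varianceD// vLE vEE cE -!EFinM -EFinN -!EFinD.
  rewrite !lee_fin ler_norml => ? ?; have := vEK x; lra.
have VD x : 0 < x -> ((1 / x ^+ 2)%:E * variance P (D x))%E =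
    (vL + (2 * c x) / x + vE x / x ^+ 2)%:E.
  move=> x0; have -> : D x = (x \o* L \+ E x)%R.
    by apply/funext => w; rewrite /E/=; ring.
  have xL : (x \o* L)%R \in Lfun P 2%:E by rewrite Lfun_scale// ler1n.
  rewrite varianceD// varianceZ// covarianceZl; last 3 first.
  - by rewrite Lfun_subset12 ?fin_num_measure.
  - by rewrite Lfun_subset12 ?fin_num_measure.
  - exact: Lfun2_mul_Lfun1.
  rewrite vLE vEE cE -!EFinM; congr EFin.
  by have := lt0r_neq0 x0 => x1; field.
rewrite vLE.
apply: (@cvg_trans _ ((vL + (2 * c x) / x + vE x / x ^+ 2)%:E @[x --> +oo])).
  by apply: near_eq_cvg; near=> x; rewrite VD.
apply: cvg_EFin; first exact: nearW.
have cst_over (k : R) : k / x @[x --> +oo] --> 0.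
  rewrite -[X in _ --> X](mulr0 k); apply: cvgM; first exact: cvg_cst.
  apply/gtr0_cvgV0; last exact: cvg_id.
  exact: nbhs_pinfty_gt.
have cst_add (k : R) : vL + k / x @[x --> +oo] --> vL.
  rewrite -[X in _ --> X]addr0; apply: cvgD; first exact: cvg_cst.
  exact: cst_over.
apply: (squeeze_cvgr _ (cst_add (- (vL + 2 * K))) (cst_add (vL + 2 * K))).
near=> x; have x1 : 1 <= x by near: x; exact: nbhs_pinfty_ge.
have x0 : 0 < x by lra.
have xV0 : 0 < x^-1 by rewrite invr_gt0.
have xV1 : x^-1 <= 1 by rewrite invf_le1.
have [] := (cK x, vEK x); have := vE0 x; rewrite /= -exprVn ler_norml.
move: (c x) (vE x) (x^-1) xV0 xV1 => p q y y0 y1 q0 /andP[p1 p2] q1.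
have yq : y * q <= K by nra.
have yq0 : 0 <= y * q by rewrite mulr_ge0// ltW.
by apply/andP; split; nra.
Unshelve. all: by end_near. Qed.

End SquareIntegrable.

(** * The Gaussian density and its tail *)

Section NormalTail.
Variable R : realType.
Implicit Types (a t x : R) (f F : R -> R).
Local Notation mu := (@lebesgue_measure R).
Local Notation phi := (@normal_pdf R 0 1).
Local Notation peak := (@normal_peak R 1).

(** The identity as a random variable, whose distribution function under the
    normal law is 1 - upper_tail. *)
Definition id_RV : measurableTypeR R -> R := idfun.
HB.instance Definition _ :=
  @isMeasurableFun.Build _ _ _ _ id_RV (@measurable_id _ _ setT).

(** The tail is defined as a complement so that it is differentiable on the
    whole line by the fundamental theorem of calculus. *)
Definition upper_tail x : R := 1 - \int[mu]_(t in `]-oo, x]) phi t.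
Local Notation Q := upper_tail.

Lemma std_pdfE x : phi x = peak * expR (- x ^+ 2 / 2).
Proof.
by rewrite normal_pdfE ?oner_neq0// /normal_fun subr0 expr1n.
Qed.

Lemma peakE : peak = (Num.sqrt 2 * Num.sqrt pi)^-1.
Proof.
by rewrite /normal_peak expr1n mul1r -mulr_natl sqrtrM.
Qed.

Lemma peak_sqr : peak ^+ 2 = (2 * pi)^-1.
Proof. by rewrite peakE exprVn exprMn !sqr_sqrtr// pi_ge0. Qed.

Lemma std_pdf_ge0 x : 0 <= phi x. Proof. exact: normal_pdf_ge0. Qed.

Lemma std_pdf_even x : phi (- x) = phi x.
Proof. by rewrite !std_pdfE sqrrN. Qed.

#[global] Instance is_derive_std_pdf x : is_derive x 1 phi (- (x * phi x)).
Proof.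
have std_pdfE' : phi = (fun y => peak * expR (- y ^+ 2 / 2)).
  by apply/funext => y; rewrite std_pdfE.
have dq : is_derive x 1 (fun y : R => - y ^+ 2 / 2) (- x).
  by apply: is_derive_eq; rewrite ?scaler0 /GRing.scale/=; lra.
have de : is_derive x 1 (expR \o (fun y : R => - y ^+ 2 / 2))
    (expR (- x ^+ 2 / 2) * (- x)).
  exact: is_derive1_comp.
have : is_derive x 1 (peak *: (expR \o (fun y : R => - y ^+ 2 / 2)))
    (peak *: (expR (- x ^+ 2 / 2) * (- x))).
  exact: is_deriveZ.
rewrite std_pdfE' => /is_derive_eq; apply.
by rewrite /GRing.scale/=; ring.
Qed.

Lemma continuous_std_pdf : continuous phi.
Proof. by apply: continuous_normal_pdf; rewrite oner_neq0. Qed.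

#[global] Instance is_derive_upper_tail x : is_derive x 1 Q (- phi x).
Proof.
have ii : mu.-integrable `]-oo, x + 1] (EFin \o phi).
  by apply: (integrableS measurableT) => //; exact: integrable_normal_pdf.
have x1 : x < x + 1 by rewrite ltrDl.
have [d1 d2] := continuous_FTC1 x1 ii (ltNyr x) (@continuous_std_pdf x).
have dP : is_derive x 1 (fun x => \int[mu]_(t in `]-oo, x]) phi t) (phi x).
  by split; [exact: d1|rewrite -derive1E; exact: d2].
by rewrite /upper_tail; apply: is_derive_eq; rewrite add0r mul1r.
Qed.

Lemma upper_tail_cvg0 : Q x @[x --> +oo] --> 0.
Proof.
pose N : probability (measurableTypeR R) R := @normal_prob R 0 1.
have cQ x : cdf (id_RV : {RV N >-> R}) x = (1 - Q x)%:E.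
  rewrite /cdf /distribution /= /pushforward /= /upper_tail subKr.
  rewrite /normal_prob /Rintegral fineK//.
  rewrite -[X in X \is a fin_num]/(normal_prob 0 1 `]-oo, x]).
  exact: fin_num_measure.
have : (1 - Q x)%:E @[x --> +oo] --> 1%:E.
  have := @cvg_cdfy1 _ _ _ N (id_RV : {RV N >-> R}).
  by apply: cvg_trans; apply: near_eq_cvg; near=> x; rewrite cQ.
move/fine_cvg => /= Q1.
rewrite (_ : Q = (fun x => 1 - (1 - Q x))); last first.
  by apply/funext => x; rewrite subKr.
rewrite -[X in _ --> X](subrr 1); apply: cvgB => //; exact: cvg_cst.
Unshelve. all: by end_near. Qed.

Lemma continuous_derivable f : (forall x, derivable f x 1) -> continuous f.
Proof. by move=> df x; exact/differentiable_continuous/derivable1_diffP. Qed.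

(** An improper integral with an antiderivative defined on the whole line: no
    one-sided condition at a is left to check. *)
Lemma integral_tail f F a l :
  (forall x, is_derive x 1 F (f x)) -> (forall x, derivable f x 1) ->
  (forall x, a <= x -> 0 <= f x) -> F x @[x --> +oo] --> l ->
  (\int[mu]_(x in `[a, +oo[) (f x)%:E = (l - F a)%:E)%E.
Proof.
move=> dF df f0 Fl; rewrite (@ge0_continuous_FTC2y _ _ F a l) -?EFinB//.
- by apply: continuous_subspaceT; exact: continuous_derivable.
- apply: cvg_at_right_filter.
  by apply: continuous_derivable => y; case: (dF y).
- by move=> x _; rewrite derive1E derive_val.
Qed.

Lemma integral_std_pdf_tail a : (\int[mu]_(x in `[a, +oo[) (phi x)%:E = (Q a)%:E)%E.
Proof.
rewrite (_ : Q a = 0 - - Q a); last by rewrite opprK add0r.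
apply: (@integral_tail phi (fun x => - Q x)).
- by move=> x; apply: is_derive_eq; rewrite opprK.
- by move=> x; have [] := is_derive_std_pdf x.
- by move=> x _; exact: std_pdf_ge0.
- by rewrite -[X in _ --> X]oppr0; apply: cvgN; exact: upper_tail_cvg0.
Qed.

Lemma upper_tail0 : Q 0 = 2^-1.
Proof.
have := @ge0_symfun_integralT R phi std_pdf_ge0 continuous_std_pdf.
rewrite integral_normal_pdf => /(_ (fun x => esym (std_pdf_even x))).
rewrite (_ : [set x | 0 <= x] = `[0, +oo[%classic); last first.
  by apply/seteqP; split => x/=; rewrite in_itv/= andbT.
rewrite integral_std_pdf_tail -EFinM => -[]; lra.
Qed.

(** Exponential decay beats polynomial growth: e^y >= (1 + y/2)^2 >= y^2/4 at
    y = x^2/2 bounds phi by a multiple of x^-4. *)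
Lemma std_pdf_le_inv4 x : 0 < x -> phi x <= 16 * peak / x ^+ 4.
Proof.
move=> x0; have x4 : 0 < x ^+ 4 by rewrite exprn_gt0.
have p0 : 0 < peak by rewrite normal_peak_gt0// oner_neq0.
rewrite std_pdfE ler_pdivlMr// (mulrC 16) -!mulrA ler_pM2l//.
rewrite mulNr expRN mulrC ler_pdivrMr ?expR_gt0//.
have -> : x ^+ 2 / 2 = x ^+ 2 / 4 + x ^+ 2 / 4 by lra.
have := expR_ge1Dx (x ^+ 2 / 4); rewrite expRD.
have : 0 <= x ^+ 2 by rewrite sqr_ge0.
rewrite (_ : x ^+ 4 = x ^+ 2 * x ^+ 2); last by ring.
move: (x ^+ 2) (expR _) => y e y0 ye; nra.
Qed.

Lemma cvg_powM_std_pdf n : (n <= 3)%N -> x ^+ n * phi x @[x --> +oo] --> 0.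
Proof.
move=> n3; pose k := 16 * peak.
have kx : k / x @[x --> +oo] --> 0.
  rewrite -[X in _ --> X](mulr0 k); apply: cvgM; first exact: cvg_cst.
  apply/gtr0_cvgV0; last exact: cvg_id.
  exact: nbhs_pinfty_gt.
apply: (squeeze_cvgr _ (cvg_cst 0) kx).
near=> x; have x1 : 1 <= x by near: x; exact: nbhs_pinfty_ge.
have x0 : 0 < x by lra.
rewrite mulr_ge0 ?std_pdf_ge0 ?exprn_ge0 ?(ltW x0)//=.
apply: (@le_trans _ _ (x ^+ 3 * phi x)).
  by rewrite ler_wpM2r ?std_pdf_ge0// ler_weXn2l.
rewrite (le_trans (ler_wpM2l _ (std_pdf_le_inv4 x0))) ?exprn_ge0 ?(ltW x0)//.
rewrite le_eqVlt; apply/orP; left; apply/eqP.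
by rewrite /k; have := lt0r_neq0 x0 => x'; field.
Unshelve. all: by end_near. Qed.

Lemma cvg_std_pdf : phi x @[x --> +oo] --> 0.
Proof.
have := @cvg_powM_std_pdf 0 isT; apply: cvg_trans; apply: near_eq_cvg.
by apply: nearW => x; rewrite expr0 mul1r.
Qed.

Lemma cvg_Mstd_pdf : x * phi x @[x --> +oo] --> 0.
Proof.
have := @cvg_powM_std_pdf 1 isT; apply: cvg_trans; apply: near_eq_cvg.
by apply: nearW => x; rewrite expr1.
Qed.

(** The antiderivatives of x^k phi are obtained from phi' = - x phi. *)
Lemma integral_Mstd_pdf_tail a : 0 <= a ->
  (\int[mu]_(x in `[a, +oo[) (x * phi x)%:E = (phi a)%:E)%E.
Proof.
move=> a0; rewrite (_ : phi a = 0 - - phi a); last by rewrite opprK add0r.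
apply: (@integral_tail (fun x => x * phi x) (fun x => - phi x)).
- by move=> x; apply: is_derive_eq; rewrite opprK.
- by move=> x; apply: ex_derive.
- by move=> x ax; rewrite mulr_ge0 ?std_pdf_ge0// (le_trans a0).
- by rewrite -[X in _ --> X]oppr0; apply: cvgN; exact: cvg_std_pdf.
Qed.

Lemma integral_sqrMstd_pdf_tail a : 0 <= a ->
  (\int[mu]_(x in `[a, +oo[) (x ^+ 2 * phi x)%:E = (a * phi a + Q a)%:E)%E.
Proof.
move=> a0; rewrite (_ : a * phi a + Q a = 0 - (- (a * phi a) - Q a)); last by ring.
apply: (@integral_tail (fun x => x ^+ 2 * phi x) (fun x => - (x * phi x) - Q x)).
- by move=> x; apply: is_derive_eq; rewrite /GRing.scale/=; ring.
- by move=> x; apply: ex_derive.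
- by move=> x ax; rewrite mulr_ge0 ?std_pdf_ge0// sqr_ge0.
- rewrite -[X in _ --> X](subrr 0) -[X in X - _]oppr0.
  by apply: cvgB; [apply: cvgN; exact: cvg_Mstd_pdf|exact: upper_tail_cvg0].
Qed.

Lemma integral_pow4Mstd_pdf_tail0 :
  (\int[mu]_(x in `[0%R, +oo[) (x ^+ 4 * phi x)%:E = (3 / 2)%:E)%E.
Proof.
rewrite (_ : 3 / 2 = 0 - (- (0 ^+ 3 * phi 0) - 3 * (0 * phi 0) - 3 * Q 0)); last first.
  rewrite upper_tail0; ring.
apply: (@integral_tail (fun x => x ^+ 4 * phi x)
   (fun x => - (x ^+ 3 * phi x) - 3 * (x * phi x) - 3 * Q x)).
- by move=> x; apply: is_derive_eq; rewrite /GRing.scale/=; ring.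
- by move=> x; apply: ex_derive.
- by move=> x ax; rewrite mulr_ge0 ?std_pdf_ge0// exprn_even_ge0.
- rewrite [X in _ --> X](_ : 0 = - 0 - 3 * 0 - 3 * 0); last by ring.
  apply: cvgB; first apply: cvgB.
  + by apply: cvgN; exact: (@cvg_powM_std_pdf 3 isT).
  + by apply: cvgM; [exact: cvg_cst|exact: cvg_Mstd_pdf].
  + by apply: cvgM; [exact: cvg_cst|exact: upper_tail_cvg0].
Qed.

End NormalTail.

(** * Integration against the normal law *)

Section NormalDensity.
Variable R : realType.
Local Notation mu := (@lebesgue_measure R).
Variables m s : R.
Local Notation N := (normal_prob m s).
Local Notation pdf := (normal_pdf m s).

Import HBNNSimple.

Let integral_normal_nnsfun (h : {nnsfun _ >-> R}) :
  (\int[N]_x (h x)%:E = \int[mu]_x ((h x)%:E * (pdf x)%:E))%E.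
Proof.
under [LHS]eq_integral do rewrite fimfunE -fsumEFin//.
rewrite [LHS]ge0_integral_fsum//; last 2 first.
  - by move=> r; exact/measurable_EFinP/measurableT_comp.
  - by move=> r x _; rewrite EFinM nnfun_muleindic_ge0.
under [RHS]eq_integral.
  move=> x xD; rewrite fimfunE -fsumEFin// muleC ge0_mule_fsumr; last first.
    by move=> r; rewrite EFinM nnfun_muleindic_ge0.
  over.
rewrite [RHS]ge0_integral_fsum//; last 2 first.
  - move=> r; apply/measurable_EFinP/measurable_funM.
      exact: measurable_normal_pdf.
    exact/measurableT_comp.
  - move=> r x _; rewrite EFinM mule_ge0//; last by rewrite nnfun_muleindic_ge0.
    by rewrite lee_fin normal_pdf_ge0.
apply: eq_fsbigr => r; rewrite inE => -[y _ hy].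
have r0 : (0 <= r%:E)%E by rewrite lee_fin -hy.
have mA : measurable (h @^-1` [set r]) by [].
under [RHS]eq_integral do rewrite EFinM muleCA.
rewrite integralZl_indic_nnsfun// integral_indic// setIT.
rewrite [RHS]ge0_integralZl//; last 2 first.
- apply: emeasurable_funM; apply/measurable_EFinP; first exact: measurable_normal_pdf.
  exact: measurable_indic.
- by move=> x _; rewrite -EFinM lee_fin mulr_ge0 ?normal_pdf_ge0// indicE.
congr (_ * _)%E; rewrite [LHS]integral_mkcond; apply: eq_integral => x _.
rewrite patchE indicE; case: ifPn => xA; first by rewrite mule1.
by rewrite mule0.
Qed.

(** From simple functions to nonnegative measurable ones by monotone
    convergence. *)
Lemma ge0_integral_normal_prob (f : measurableTypeR R -> \bar R) :
  measurable_fun setT f -> (forall x, 0 <= f x)%E ->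
  (\int[N]_x f x = \int[mu]_x (f x * (pdf x)%:E))%E.
Proof.
move=> mf f0; pose f_ := nnsfun_approx measurableT mf.
have mpdf : measurable_fun setT (fun x => (pdf x)%:E).
  by apply/measurable_EFinP; exact: measurable_normal_pdf.
transitivity (lim (\int[N]_x (f_ n x)%:E @[n --> \oo])%E).
  rewrite -monotone_convergence//=.
  - apply: eq_integral => ? /[!inE] xD; apply/esym/cvg_lim => //=.
    exact: cvg_nnsfun_approx.
  - move=> n; apply/measurable_EFinP; exact: measurable_funTS.
  - by move=> n ? _; rewrite lee_fin.
  - by move=> ? _ ? ? mn; rewrite lee_fin; exact/lefP/nd_nnsfun_approx.
under eq_fun do rewrite integral_normal_nnsfun.
rewrite -monotone_convergence//=.
- apply: eq_integral => x /[!inE] xD; apply/cvg_lim => //=.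
  by apply: cvgeZr => //; exact: cvg_nnsfun_approx.
- move=> n; apply: emeasurable_funM => //.
  by apply/measurable_EFinP; exact: measurable_funTS.
- by move=> n x _; rewrite mule_ge0// lee_fin ?normal_pdf_ge0.
- move=> x _ a b ab; rewrite lee_wpmul2r ?lee_fin ?normal_pdf_ge0//.
  exact/lefP/nd_nnsfun_approx.
Qed.

End NormalDensity.

(** * Gaussian integrals of a minimum *)

Section HalfLine.
Variable R : realType.
Implicit Types (a t x : R) (f F : R -> R).
Local Notation mu := (@lebesgue_measure R).
Local Notation N := (@normal_prob R 0 1).
Local Notation phi := (@normal_pdf R 0 1).
Local Notation peak := (@normal_peak R 1).
Local Notation Q := (@upper_tail R).

(** Truncating x at t only changes the integrand beyond t. *)
Lemma integral_min_split (p q : nat) t (A B C : R) : 0 <= t ->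
  (\int[mu]_(x in `[0%R, +oo[) (x ^+ (p + q) * phi x)%:E = A%:E)%E ->
  (\int[mu]_(x in `[t, +oo[) (x ^+ (p + q) * phi x)%:E = B%:E)%E ->
  (\int[mu]_(x in `[t, +oo[) (x ^+ q * phi x)%:E = C%:E)%E ->
  (\int[mu]_(x in `[0%R, +oo[) (Order.min x t ^+ p * x ^+ q * phi x)%:E
    = (A - B + t ^+ p * C)%:E)%E.
Proof.
move=> t0 hA hB hC.
have mX n (D : set R) : measurable D ->
    measurable_fun D (fun x : R => (x ^+ n * phi x)%:E).
  move=> mD; apply/measurable_EFinP; apply: measurable_funTS.
  by apply: measurable_funM; [exact: measurable_funX|exact: measurable_normal_pdf].
have split0t : `[0%R, +oo[%classic = `[0%R, t[%classic `|` `[t, +oo[%classic :> set R.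
  by rewrite (@itv_bndbnd_setU _ _ (BLeft 0) (BLeft t) +oo%O).
have disj : [disjoint `[0%R, t[%classic & `[t, +oo[%classic :> set R].
  apply/disj_setPS => x/= []; rewrite !in_itv/= andbT => /andP[_ xt].
  by rewrite leNgt xt.
have Xge0 n x : 0 <= x -> 0 <= x ^+ n * phi x.
  by move=> x0; rewrite mulr_ge0 ?exprn_ge0// normal_pdf_ge0.
have minE x : Order.min x t ^+ p * x ^+ q * phi x =
    if x < t then x ^+ (p + q) * phi x else t ^+ p * (x ^+ q * phi x).
  by rewrite minElt; case: ifPn => _; rewrite ?exprD ?mulrA.
have cover0t x : (x \in `[0%R, t[) \/ (x \in `[t, +oo[) -> 0 <= x.
  by rewrite !in_itv/= andbT => -[/andP[]//|]; exact: le_trans.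
have lower : (\int[mu]_(x in `[0%R, t[) (x ^+ (p + q) * phi x)%:E = (A - B)%:E)%E.
  move: hA; rewrite split0t ge0_integral_setU//=; last 2 first.
  - by apply: mX; exact: measurableU.
  - by move=> x /cover0t x0; rewrite lee_fin Xge0.
  by rewrite hB EFinB => <-; rewrite addeK.
rewrite split0t ge0_integral_setU//=; last 2 first.
- apply/measurable_EFinP; apply: measurable_funTS.
  apply: measurable_funM; last exact: measurable_normal_pdf.
  apply: measurable_funM; last exact: measurable_funX.
  by apply: measurable_funX; exact: measurable_minr.
- move=> x /cover0t x0.
  by rewrite lee_fin minE; case: ifP => _; rewrite ?Xge0// mulr_ge0 ?exprn_ge0// Xge0.
rewrite EFinD -lower EFinM -hC; congr (_ + _)%E.
  by apply: eq_integral => x; rewrite inE/= in_itv/= minE => /andP[_ ->].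
rewrite -ge0_integralZl//; last 3 first.
- exact: mX.
- by move=> x/=; rewrite in_itv/= andbT => tx; rewrite lee_fin Xge0// (le_trans t0).
- by rewrite lee_fin exprn_ge0.
apply: eq_integral => x; rewrite inE/= in_itv/= andbT => tx.
by rewrite minE ltNge tx.
Qed.

Let tail0 a : (\int[mu]_(x in `[a, +oo[) (x ^+ 0 * phi x)%:E = (Q a)%:E)%E.
Proof.
by under eq_integral do rewrite expr0 mul1r; exact: integral_std_pdf_tail.
Qed.

Let tail1 a : 0 <= a ->
  (\int[mu]_(x in `[a, +oo[) (x ^+ 1 * phi x)%:E = (phi a)%:E)%E.
Proof.
by move=> a0; under eq_integral do rewrite expr1; exact: integral_Mstd_pdf_tail.
Qed.

Lemma std_pdf0 : phi 0 = peak.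
Proof. by rewrite std_pdfE expr0n/= oppr0 mul0r expR0 mulr1. Qed.

Lemma integral_min t : 0 <= t ->
  (\int[mu]_(x in `[0%R, +oo[) (Order.min x t ^+ 1 * x ^+ 0 * phi x)%:E
    = (peak - phi t + t * Q t)%:E)%E.
Proof.
move=> t0; rewrite -std_pdf0 -[X in X * Q t]expr1.
by apply: integral_min_split => //; exact: tail1.
Qed.

Lemma integral_min_sqr t : 0 <= t ->
  (\int[mu]_(x in `[0%R, +oo[) (Order.min x t ^+ 2 * x ^+ 0 * phi x)%:E
    = (2^-1 - (t * phi t + Q t) + t ^+ 2 * Q t)%:E)%E.
Proof.
move=> t0; apply: integral_min_split => //.
  by rewrite addn0 integral_sqrMstd_pdf_tail// mul0r add0r upper_tail0.
by rewrite addn0 integral_sqrMstd_pdf_tail.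
Qed.

Lemma integral_min_mul t : 0 <= t ->
  (\int[mu]_(x in `[0%R, +oo[) (Order.min x t ^+ 1 * x ^+ 1 * phi x)%:E
    = (2^-1 - Q t)%:E)%E.
Proof.
move=> t0; rewrite (_ : 2^-1 - Q t = 2^-1 - (t * phi t + Q t) + t ^+ 1 * phi t);
  last ring.
apply: integral_min_split => //; last exact: tail1.
  by rewrite integral_sqrMstd_pdf_tail// mul0r add0r upper_tail0.
by rewrite integral_sqrMstd_pdf_tail.
Qed.

(** The integral of the squared density over [t, +oo): the squared density is
    again Gaussian, with half the variance. *)
Definition sqr_tail t : R := peak ^+ 2 * Num.sqrt pi * Q (Num.sqrt 2 * t).

#[local] Instance is_derive_sqr_tail t : is_derive t 1 sqr_tail (- phi t ^+ 2).
Proof.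
have dl : is_derive t 1 (fun u : R => Num.sqrt 2 * u) (Num.sqrt 2).
  by apply: is_derive_eq; rewrite /GRing.scale/=; ring.
have dQ : is_derive t 1 (Q \o (fun u : R => Num.sqrt 2 * u))
    (- phi (Num.sqrt 2 * t) * Num.sqrt 2).
  exact: is_derive1_comp.
have := is_deriveZ (peak ^+ 2 * Num.sqrt pi) dQ.
rewrite /sqr_tail => /is_derive_eq; apply.
rewrite /GRing.scale/= !std_pdfE.
have -> : - (Num.sqrt 2 * t) ^+ 2 / 2 = - t ^+ 2 / 2 + - t ^+ 2 / 2.
  by rewrite exprMn sqr_sqrtr//; lra.
rewrite expRD.
have pk : peak * Num.sqrt pi * Num.sqrt 2 = 1.
  by rewrite peakE -mulrA (mulrC (Num.sqrt pi)) mulVf// mulf_neq0// gt_eqF//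
    sqrtr_gt0// pi_gt0.
by rewrite -[RHS]mulr1 -[X in _ = _ * X]pk; ring.
Qed.

Lemma sqr_tail0 : sqr_tail 0 = (4 * Num.sqrt pi)^-1.
Proof.
rewrite /sqr_tail mulr0 upper_tail0 peak_sqr -[X in (2 * X)^-1]sqr_sqrtr ?pi_ge0//.
have s1 : Num.sqrt pi != 0 :> R by rewrite gt_eqF// sqrtr_gt0 pi_gt0.
by move: (Num.sqrt pi) s1 => s s1; field.
Qed.

Lemma cvg_sqr_tail : sqr_tail t @[t --> +oo] --> 0.
Proof.
rewrite [X in _ --> X](_ : 0 = peak ^+ 2 * Num.sqrt pi * 0); last by rewrite mulr0.
apply: cvgM; first exact: cvg_cst.
apply: (cvg_comp _ _ _ (@upper_tail_cvg0 R)).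
apply: gt0_cvgMry; last exact: cvg_id.
by rewrite sqrtr_gt0.
Qed.

Let cvg_prod0 f F : f x @[x --> +oo] --> 0 -> F x @[x --> +oo] --> 0 ->
  f x * F x @[x --> +oo] --> 0.
Proof. by move=> f0 F0; rewrite -[X in _ --> X](mulr0 0); exact: cvgM. Qed.

(** In the next three lemmas the integrand is an inner integral of a power of
    min (s, t), as computed above; the antiderivatives follow from phi' = - t phi
    and Q' = - phi. *)
Lemma integral_min_std_pdf : (\int[mu]_(t in `[0%R, +oo[)
  ((peak - phi t + t * Q t) * phi t)%:E = (peak - (2 * Num.sqrt pi)^-1)%:E)%E.
Proof.
pose F t := - (peak * Q t) + 2 * sqr_tail t - phi t * Q t.
rewrite (_ : peak - _ = 0 - F 0); last first.
  rewrite /F sqr_tail0 upper_tail0 std_pdf0 invfM (invfM 4).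
  by move: (Num.sqrt pi)^-1 peak => s p; field.
apply: (@integral_tail _ _ F).
- by move=> x; apply: is_derive_eq; rewrite /GRing.scale/=; ring.
- by move=> x; apply: ex_derive.
- move=> x x0; rewrite mulr_ge0 ?normal_pdf_ge0//.
  rewrite -lee_fin -integral_min// integral_ge0// => y/=.
  rewrite in_itv/= andbT => y0.
  by rewrite lee_fin !mulr_ge0 ?normal_pdf_ge0 ?exprn_ge0 ?le_min ?y0.
- rewrite [X in _ --> X](_ : 0 = - (peak * 0) + 2 * 0 - 0); last by ring.
  apply: cvgB; last by apply: cvg_prod0; [exact: cvg_std_pdf|exact: upper_tail_cvg0].
  apply: cvgD.
    by apply: cvgN; apply: cvgM; [exact: cvg_cst|exact: upper_tail_cvg0].
  by apply: cvgM; [exact: cvg_cst|exact: cvg_sqr_tail].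
Qed.

Lemma integral_min_sqr_std_pdf : (\int[mu]_(t in `[0%R, +oo[)
  ((2^-1 - (t * phi t + Q t) + t ^+ 2 * Q t) * phi t)%:E
    = (4^-1 - (2 * pi)^-1)%:E)%E.
Proof.
pose F t := - (2^-1 * Q t) + phi t ^+ 2 - (t * phi t) * Q t.
rewrite (_ : 4^-1 - _ = 0 - F 0); last first.
  by rewrite /F upper_tail0 std_pdf0 peak_sqr; move: (2 * pi)^-1 => s; field.
apply: (@integral_tail _ _ F).
- by move=> x; apply: is_derive_eq; rewrite /GRing.scale/=; field.
- by move=> x; apply: ex_derive.
- move=> x x0; rewrite mulr_ge0 ?normal_pdf_ge0//.
  rewrite -lee_fin -integral_min_sqr// integral_ge0// => y/=.
  rewrite in_itv/= andbT => y0.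
  by rewrite lee_fin !mulr_ge0 ?normal_pdf_ge0 ?exprn_ge0 ?le_min ?y0.
- rewrite [X in _ --> X](_ : 0 = - (2^-1 * 0) + 0 - 0); last by ring.
  apply: cvgB; last by apply: cvg_prod0; [exact: cvg_Mstd_pdf|exact: upper_tail_cvg0].
  apply: cvgD; last by apply: cvg_prod0; exact: cvg_std_pdf.
  by apply: cvgN; apply: cvgM; [exact: cvg_cst|exact: upper_tail_cvg0].
Qed.

Lemma integral_min_mul_std_pdf : (\int[mu]_(t in `[0%R, +oo[)
  ((t * (2^-1 - Q t)) * phi t)%:E = (4 * Num.sqrt pi)^-1%:E)%E.
Proof.
pose F t := - (phi t * (2^-1 - Q t)) - sqr_tail t.
rewrite (_ : (4 * _)^-1 = 0 - F 0); last first.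
  by rewrite /F sqr_tail0 upper_tail0 std_pdf0; move: (_ * _)^-1 => s; ring.
apply: (@integral_tail _ _ F).
- by move=> x; apply: is_derive_eq; rewrite /GRing.scale/=; ring.
- by move=> x; apply: ex_derive.
- move=> x x0; rewrite !mulr_ge0 ?normal_pdf_ge0//.
  rewrite -lee_fin -integral_min_mul// integral_ge0// => y/=.
  rewrite in_itv/= andbT => y0.
  by rewrite lee_fin !mulr_ge0 ?normal_pdf_ge0 ?expr1// le_min y0.
- rewrite [X in _ --> X](_ : 0 = - (0 * (2^-1 - 0)) - 0); last by ring.
  apply: cvgB; last exact: cvg_sqr_tail.
  apply: cvgN; apply: cvgM; first exact: cvg_std_pdf.
  by apply: cvgB; [exact: cvg_cst|exact: upper_tail_cvg0].
Qed.

End HalfLine.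

(** * Double integrals of even functions *)

Section DoubleIntegrals.
Variable R : realType.
Implicit Types (x y s t : R) (f g G : R -> R).
Local Notation mu := (@lebesgue_measure R).
Local Notation N := (@normal_prob R 0 1).
Local Notation phi := (@normal_pdf R 0 1).

Lemma integral_even_normal f : continuous f -> (forall x, 0 <= x -> 0 <= f x) ->
  (\int[N]_x (f `|x|)%:E = 2%:E * \int[mu]_(x in `[0%R, +oo[) (f x * phi x)%:E)%E.
Proof.
move=> cf f0; have cfn : continuous (fun x => f `|x|).
  by move=> x; apply: (continuous_comp (@norm_continuous _ _ x)); exact: cf.
rewrite ge0_integral_normal_prob; last 2 first.
- by apply/measurable_EFinP; exact: continuous_measurable_fun.
- by move=> x; rewrite lee_fin f0.
under eq_integral do rewrite -EFinM.
rewrite (@ge0_symfun_integralT _ (fun x => f `|x| * phi x)).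
- congr (_ * _)%E.
  rewrite (_ : [set x | 0 <= x] = `[0, +oo[%classic); last first.
    by apply/seteqP; split => x/=; rewrite in_itv/= andbT.
  apply: eq_integral => x; rewrite inE/= in_itv/= andbT => x0.
  by rewrite ger0_norm.
- by move=> x; rewrite mulr_ge0 ?f0// normal_pdf_ge0.
- by move=> x; apply: continuousM; [exact: cfn|exact: continuous_std_pdf].
- by move=> x /=; rewrite normrN std_pdf_even.
Qed.

(** By evenness each integral over the line is twice one over the half-line. *)
Lemma double_integral_even (F : R -> R -> R) G c :
  (forall s, continuous (F s)) -> continuous G ->
  (forall s t, 0 <= s -> 0 <= t -> 0 <= F s t) ->
  (forall s, 0 <= s ->
    (\int[mu]_(t in `[0%R, +oo[) (F s t * phi t)%:E = (G s)%:E)%E) ->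
  (\int[mu]_(s in `[0%R, +oo[) (G s * phi s)%:E = c%:E)%E ->
  (\int[N]_x \int[N]_y (F `|x| `|y|)%:E = (4 * c)%:E)%E.
Proof.
move=> cF cG F0 FG Gc.
have G0 s : 0 <= s -> 0 <= G s.
  move=> s0; rewrite -lee_fin -FG// integral_ge0// => t/=.
  rewrite in_itv/= andbT => t0.
  by rewrite lee_fin mulr_ge0 ?F0// normal_pdf_ge0.
transitivity (\int[N]_x (2 * G `|x|)%:E)%E.
  apply: eq_integral => x _.
  by rewrite (integral_even_normal (cF _)) ?FG// => t t0; exact: F0.
rewrite (@integral_even_normal (fun x => 2 * G x)).
- under eq_integral do rewrite -mulrA EFinM.
  rewrite ge0_integralZl//.
  + by rewrite Gc -!EFinM; congr EFin; ring.
  + apply/measurable_EFinP; apply: measurable_funTS; apply: measurable_funM.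
      exact: continuous_measurable_fun.
    exact: measurable_normal_pdf.
  + move=> s/=; rewrite in_itv/= andbT => s0.
    by rewrite lee_fin mulr_ge0 ?G0// normal_pdf_ge0.
- by move=> x; apply: cvgM; [exact: cvg_cst|exact: cG].
- by move=> x x0; rewrite mulr_ge0// G0.
Qed.

(** The two half-lines exchange their contributions under x |-> - x. *)
Lemma integral_normal_opp g : continuous g -> (forall x, 0 <= g x) ->
  (\int[N]_x (g (- x))%:E = \int[N]_x (g x)%:E)%E.
Proof.
have half (h : R -> R) : continuous h -> (forall x, 0 <= h x) ->
    (\int[N]_x (h x)%:E = \int[mu]_(x in `[0%R, +oo[) (h (- x) * phi x)%:E +
      \int[mu]_(x in `[0%R, +oo[) (h x * phi x)%:E)%E.
  move=> ch h0; pose k x := h x * phi x.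
  have ck : continuous k.
    by move=> x; apply: continuousM; [exact: ch|exact: continuous_std_pdf].
  have k0 x : 0 <= k x by rewrite mulr_ge0// normal_pdf_ge0.
  have mk D : measurable D -> measurable_fun D (EFin \o k).
    move=> mD; apply/measurable_EFinP; apply: measurable_funTS.
    exact: continuous_measurable_fun.
  rewrite ge0_integral_normal_prob; last 2 first.
  - by apply/measurable_EFinP; exact: continuous_measurable_fun.
  - by move=> x; rewrite lee_fin.
  under eq_integral do rewrite -EFinM -/(k _).
  rewrite -(setUv `]-oo, 0%R]) ge0_integral_setU//=; last 4 first.
  - exact: measurableC.
  - rewrite setUv; exact: mk.
  - by move=> x _; rewrite lee_fin.
  - by apply/disj_setPS => x [].
  congr (_ + _)%E.
    rewrite -[0 in LHS]oppr0 ge0_integration_by_substitutionNy//.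
    + by apply: eq_integral => x _; rewrite /k/= std_pdf_even.
    + exact: continuous_subspaceT.
  rewrite setCitvl -integral_itv_obnd_cbnd//.
  exact: mk.
move=> cg g0; rewrite !half//.
- by under eq_integral do rewrite opprK; rewrite addeC.
- move=> x; apply: (@continuous_comp _ _ _ (fun x => - x) g); last exact: cg.
  exact: opp_continuous.
Qed.

End DoubleIntegrals.

(** * Independent standard Gaussian pairs *)

Section GaussianPair.
Context (d : measure_display) (T : measurableType d) (R : realType).
Variable P : probability T R.
Variables X Y : {RV P >-> R}.
Hypothesis gaussianX : standard_gaussian X.
Hypothesis gaussianY : standard_gaussian Y.
Hypothesis indepXY : forall A B : set R, measurable A -> measurable B ->
  (P (X @^-1` A `&` Y @^-1` B) = P (X @^-1` A) * P (Y @^-1` B))%E.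
Local Notation mu := (@lebesgue_measure R).
Local Notation N := (@normal_prob R 0 1).
Local Notation phi := (@normal_pdf R 0 1).
Local Notation RT := (measurableTypeR R).

(** The normal law lives on the Borel sigma-algebra as generated by half-open
    intervals, the random variables on the canonical one of the real line; the
    two have the same measurable sets. *)
Lemma measurable_RV (Z : {RV P >-> R}) : measurable_fun setT (Z : T -> RT).
Proof. by move=> mT B mB; exact: (@measurable_funPT _ _ _ _ Z mT B mB). Qed.

Lemma integral_gaussian (Z : {RV P >-> R}) (f : RT -> \bar R) :
  standard_gaussian Z -> measurable_fun setT f -> (forall x, 0 <= f x)%E ->
  (\int[P]_w f (Z w) = \int[N]_x f x)%E.
Proof.
move=> gZ mf f0.
rewrite -[LHS](@ge0_integral_pushforward _ _ _ RT _ _ (measurable_RV Z) P setT f)//.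
apply: (@eq_measure_integral _ RT R setT N) => [|mZ A mA _].
  exact: measurable_RV.
exact: gZ.
Qed.

Let XY w : RT * RT := (X w, Y w).

Let mXY : measurable_fun setT XY.
Proof. by apply: measurable_fun_pair; exact: measurable_RV. Qed.

(** The joint law agrees with the product measure on rectangles, hence
    everywhere. *)
Lemma integral_gaussian_pair (f : RT * RT -> \bar R) :
  measurable_fun setT f -> (forall z, 0 <= f z)%E ->
  (\int[P]_w f (X w, Y w) = \int[N]_x \int[N]_y f (x, y))%E.
Proof.
move=> mf f0.
rewrite -(@fubini_tonelli1 _ _ _ _ _ N N)//.
have -> : (\int[P]_w f (X w, Y w) = \int[pushforward P XY]_z f z)%E.
  by rewrite ge0_integral_pushforward.
apply: eq_measure_integral => A mA _.
apply/esym/product_measure_unique => // A1 A2 mA1 mA2.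
transitivity (P (X @^-1` A1 `&` Y @^-1` A2)); first by [].
by rewrite indepXY//; congr (_ * _)%E; [exact: gaussianX|exact: gaussianY].
Qed.

(** (X, - Y) has the same law as (X, Y), so twice a mean is the mean of the sum
    over the two signs. *)
Lemma integral_gaussian_flip (f : R -> R -> R) :
  measurable_fun setT (fun z : RT * RT => f z.1 z.2) ->
  (forall x, continuous (f x)) -> (forall x y, 0 <= f x y) ->
  (2%:E * \int[P]_w (f (X w) (Y w))%:E =
   \int[N]_x \int[N]_y (f x y + f x (- y))%:E)%E.
Proof.
move=> mf cf f0.
have mfE : measurable_fun setT (fun z : RT * RT => (f z.1 z.2)%:E).
  exact/measurable_EFinP.
rewrite (@integral_gaussian_pair (fun z => (f z.1 z.2)%:E))//; last first.
  by move=> z; rewrite lee_fin.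
rewrite -ge0_integralZl//=; last 2 first.
- apply: (@measurable_fun_fubini_tonelli_F _ _ _ _ _ N _ mfE).
  by move=> z; rewrite lee_fin.
- by move=> x _; apply: integral_ge0 => y _; rewrite lee_fin.
apply: eq_integral => x _.
have mfx : measurable_fun setT (f x) by exact: continuous_measurable_fun.
have cfx : continuous (fun y => f x (- y)).
  move=> y; apply: (@continuous_comp _ _ _ (fun y => - y) (f x)); last exact: cf.
  exact: opp_continuous.
under [RHS]eq_integral do rewrite EFinD.
rewrite ge0_integralD//; last 4 first.
- by move=> y _; rewrite lee_fin.
- exact/measurable_EFinP.
- by move=> y _; rewrite lee_fin.
- by apply/measurable_EFinP; exact: continuous_measurable_fun.
by rewrite integral_normal_opp// mule_natl mule2n.
Qed.

Definition sign_gap (x y : R) : R := `|x| + `|y| - `|x + y|.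

(** The gap vanishes when x and y have the same sign, and is twice the smaller
    modulus otherwise; one of (x, y) and (x, - y) is in each case. *)
Lemma sign_gap_flip p x y : (0 < p)%N ->
  sign_gap x y ^+ p + sign_gap x (- y) ^+ p = (2 * Order.min `|y| `|x|) ^+ p.
Proof.
move=> p0; rewrite /sign_gap normrN.
have z0 : (0 : R) ^+ p = 0 by rewrite expr0n gtn_eqF.
set m := 2 * _; set g := _ - `|x + y|; set g' := _ - `|x - y|.
suff [[-> ->]|[-> ->]] : (g = 0 /\ g' = m) \/ (g = m /\ g' = 0).
- by rewrite z0 add0r.
- by rewrite z0 addr0.
rewrite /g /g' /m minElt.
have [x0|x0] := ger0P x; have [y0|y0] := ger0P y;
  have [xy|xy] := ger0P (x + y); have [yx|yx] := ger0P (x - y);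
  case: ifPn; rewrite -?leNgt => c;
  solve [left; split; lra | right; split; lra].
Qed.
End GaussianPair.

(** * Moments of the product and of the sign gap *)

Section GaussianMoments.
Context (d : measure_display) (T : measurableType d) (R : realType).
Variable P : probability T R.
Variables X Y : {RV P >-> R}.
Hypothesis gaussianX : standard_gaussian X.
Hypothesis gaussianY : standard_gaussian Y.
Hypothesis indepXY : forall A B : set R, measurable A -> measurable B ->
  (P (X @^-1` A `&` Y @^-1` B) = P (X @^-1` A) * P (Y @^-1` B))%E.
Local Notation mu := (@lebesgue_measure R).
Local Notation N := (@normal_prob R 0 1).
Local Notation phi := (@normal_pdf R 0 1).
Local Notation peak := (@normal_peak R 1).
Local Notation Q := (@upper_tail R).
Local Notation RT := (measurableTypeR R).

Let m1 : measurable_fun setT (fun z : RT * RT => z.1 : R).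
Proof. by move=> mT B mB; exact: (@measurable_fst _ _ RT RT mT B mB). Qed.

Let m2 : measurable_fun setT (fun z : RT * RT => z.2 : R).
Proof. by move=> mT B mB; exact: (@measurable_snd _ _ RT RT mT B mB). Qed.

Let integral_even_pair (F : R -> R -> R) (G : R -> R) (c : R) :
  measurable_fun setT (fun z : RT * RT => F `|z.1| `|z.2|) ->
  (forall s, continuous (F s)) -> continuous G ->
  (forall s t, 0 <= s -> 0 <= t -> 0 <= F s t) ->
  (forall s, 0 <= s ->
    (\int[mu]_(t in `[0%R, +oo[) (F s t * phi t)%:E = (G s)%:E)%E) ->
  (\int[mu]_(s in `[0%R, +oo[) (G s * phi s)%:E = c%:E)%E ->
  (\int[P]_w (F `|X w| `|Y w|)%:E = (4 * c)%:E)%E.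
Proof.
move=> mF cF cG F0 FG Gc.
rewrite (@integral_gaussian_pair _ _ _ P X Y gaussianX gaussianY indepXY
  (fun z => (F `|z.1| `|z.2|)%:E)).
- exact: double_integral_even FG Gc.
- exact/measurable_EFinP.
- by move=> z; rewrite lee_fin F0.
Qed.

Let integral_pow (n : nat) (a A : R) : 0 <= a ->
  (\int[mu]_(t in `[0%R, +oo[) (t ^+ n * phi t)%:E = A%:E)%E ->
  (\int[mu]_(t in `[0%R, +oo[) (a * t ^+ n * phi t)%:E = (a * A)%:E)%E.
Proof.
move=> a0 hA; under eq_integral do rewrite -mulrA EFinM.
rewrite ge0_integralZl//; first by rewrite hA.
- apply/measurable_EFinP; apply: measurable_funTS.
  by apply: measurable_funM; [exact: measurable_funX|exact: measurable_normal_pdf].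
- move=> t/=; rewrite in_itv/= andbT => t0.
  by rewrite lee_fin mulr_ge0 ?exprn_ge0// normal_pdf_ge0.
Qed.

Lemma integral_abs_prod : (\int[P]_w (`|X w * Y w|)%:E = (2 / pi)%:E)%E.
Proof.
under eq_integral do rewrite normrM.
have h1 : (\int[mu]_(t in `[0%R, +oo[) (t ^+ 1 * phi t)%:E = peak%:E)%E.
  by under eq_integral do rewrite expr1; rewrite integral_Mstd_pdf_tail// std_pdf0.
rewrite (@integral_even_pair (fun s t => s * t) (fun s => s * peak) (peak * peak)).
- rewrite -expr2 peak_sqr; congr EFin; move: (lt0r_neq0 (pi_gt0 R)).
  by generalize (pi : R) => p p0; field.
- by apply: measurable_funM; exact: measurableT_comp.
- by move=> s t; apply: cvgM; [exact: cvg_cst|exact: cvg_id].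
- move=> s; apply: cvgM; [exact: cvg_id|exact: cvg_cst].
- by move=> s t s0 t0; rewrite mulr_ge0.
- by move=> s s0; exact: (@integral_pow 1).
- under eq_integral do rewrite (mulrC _ peak).
  by apply: (@integral_pow 1) => //; exact: normal_peak_ge0.
Qed.

Lemma integral_sqr_prod : (\int[P]_w ((X w * Y w) ^+ 2)%:E = 1%:E)%E.
Proof.
under eq_integral do rewrite exprMn -(real_normK (num_real (X _)))
  -(real_normK (num_real (Y _))).
have h2 : (\int[mu]_(t in `[0%R, +oo[) (t ^+ 2 * phi t)%:E = 2^-1%:E)%E.
  by rewrite integral_sqrMstd_pdf_tail// mul0r add0r upper_tail0.
rewrite (@integral_even_pair (fun s t => s ^+ 2 * t ^+ 2)
  (fun s => s ^+ 2 * 2^-1) (2^-1 * 2^-1)).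
- by congr EFin; field.
- by apply: measurable_funM; apply: measurable_funX; exact: measurableT_comp.
- by move=> s t; apply: cvgM; [exact: cvg_cst|exact: exprn_continuous].
- move=> s; apply: cvgM; [exact: exprn_continuous|exact: cvg_cst].
- by move=> s t s0 t0; rewrite mulr_ge0// exprn_ge0.
- by move=> s s0; apply: (@integral_pow 2) => //; rewrite exprn_ge0.
- under eq_integral do rewrite (mulrC _ 2^-1).
  exact: (@integral_pow 2).
Qed.

(** A finite fourth moment makes squares of Gaussian variables square integrable,
    which is what the dominating error terms require. *)
Lemma integral_pow4 : (\int[P]_w (X w ^+ 4)%:E = 3%:E)%E.
Proof.
rewrite (@integral_gaussian _ _ _ P X (fun x : RT => (x ^+ 4)%:E) gaussianX).
- have -> : (\int[N]_x (x ^+ 4)%:E = \int[N]_x (`|x| ^+ 4)%:E)%E.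
    by apply: eq_integral => x _; rewrite (exprM `|x| 2 2) real_normK
      ?num_real// -exprM.
  rewrite (@integral_even_normal _ (fun x => x ^+ 4)).
  + by rewrite integral_pow4Mstd_pdf_tail0 -EFinM; congr EFin; field.
  + exact: exprn_continuous.
  + by move=> x x0; rewrite exprn_ge0.
- by apply/measurable_EFinP; apply: continuous_measurable_fun; exact: exprn_continuous.
- by move=> x; rewrite lee_fin exprn_even_ge0.
Qed.

Let measurable_gap_prod (p q : nat) : measurable_fun setT
  (fun z : RT * RT => sign_gap z.1 z.2 ^+ p * `|z.1 * z.2| ^+ q).
Proof.
apply: measurable_funM; apply: measurable_funX.
  apply: measurable_funB; last by apply: measurableT_comp => //; exact: measurable_funD.
  by apply: measurable_funD; exact: measurableT_comp.
by apply: measurableT_comp => //; exact: measurable_funM.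
Qed.

Lemma sign_gap_ge0 (x y : R) : 0 <= sign_gap x y.
Proof. by rewrite subr_ge0 ler_normD. Qed.

(** On each pair of quadrants the gap is twice the smaller modulus or zero, so
    its moments are half of those of twice the smaller modulus. *)
Lemma integral_sign_gap (p q : nat) (J : R -> R) (c : R) : (0 < p)%N ->
  continuous J ->
  (forall s, 0 <= s -> (\int[mu]_(t in `[0%R, +oo[)
      (Order.min t s ^+ p * t ^+ q * phi t)%:E = (J s)%:E)%E) ->
  (\int[mu]_(s in `[0%R, +oo[) (s ^+ q * J s * phi s)%:E = c%:E)%E ->
  (\int[P]_w (sign_gap (X w) (Y w) ^+ p * `|X w * Y w| ^+ q)%:E =
    (2 ^+ p.+1 * c)%:E)%E.
Proof.
move=> p0 cJ minJ Jc.
have J0 s : 0 <= s -> 0 <= J s.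
  move=> s0; rewrite -lee_fin -minJ// integral_ge0// => t/=.
  rewrite in_itv/= andbT => t0.
  by rewrite lee_fin !mulr_ge0 ?exprn_ge0 ?normal_pdf_ge0// le_min t0.
pose f (x y : R) := sign_gap x y ^+ p * `|x * y| ^+ q.
have cpow (u : R -> R) n : continuous u -> continuous (fun t => u t ^+ n).
  move=> cu t; apply: (@continuous_comp _ _ _ u (fun z => z ^+ n)).
    exact: cu.
  exact: exprn_continuous.
have cmulr (a : R) : continuous (fun t => a * t).
  by move=> t; apply: cvgM; [exact: cvg_cst|exact: cvg_id].
have cmin (a : R) : continuous (fun t => Order.min t a).
  rewrite (_ : (fun t => _) = fun t => (t + a - `|t - a|) / 2).
    move=> t; apply: cvgM; last exact: cvg_cst.
    apply: cvgB; first by apply: cvgD; [exact: cvg_id|exact: cvg_cst].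
    by apply: cvg_norm; apply: cvgB; [exact: cvg_id|exact: cvg_cst].
  by apply/funext => t; rewrite minr_absE.
have cf x : continuous (f x).
  move=> y; apply: cvgM.
    apply: (cpow (sign_gap x)) => t; apply: cvgB.
      by apply: cvgD; [exact: cvg_cst|exact: norm_continuous].
    by apply: cvg_norm; apply: cvgD; [exact: cvg_cst|exact: cvg_id].
  apply: (cpow (fun t => `|x * t|)) => t.
  by apply: cvg_norm; exact: cmulr.
have f0 x y : 0 <= f x y by rewrite mulr_ge0 ?exprn_ge0 ?sign_gap_ge0.
have := @integral_gaussian_flip _ _ _ P X Y gaussianX gaussianY indepXY f
  (measurable_gap_prod p q) cf f0.
pose F (s t : R) := (2 * Order.min t s) ^+ p * (s * t) ^+ q.
rewrite (_ : (\int[N]_x _)%E = (\int[N]_x \int[N]_y (F `|x| `|y|)%:E)%E); last first.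
  apply: eq_integral => x _; apply: eq_integral => y _; congr EFin.
  by rewrite /f /F mulrN normrN -mulrDl sign_gap_flip// normrM.
rewrite (@double_integral_even _ F (fun s => 2 ^+ p * (s ^+ q * J s)) (2 ^+ p * c)).
- set A := (\int[P]_w _)%E => h.
  have -> : A = (2^-1%:E * (2%:E * A))%E by rewrite muleA -EFinM mulVf ?mul1e.
  by rewrite h -EFinM exprS; congr EFin; field.
- move=> s t; apply: cvgM; last by apply: (cpow (fun t => s * t)); exact: cmulr.
  apply: (cpow (fun t => 2 * Order.min t s)) => {}t.
  by apply: cvgM; [exact: cvg_cst|exact: cmin].
- move=> s; apply: cvgM; first exact: cvg_cst.
  by apply: cvgM; [exact: exprn_continuous|exact: cJ].
- by move=> s t s0 t0; rewrite mulr_ge0 ?exprn_ge0 ?mulr_ge0// le_min t0.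
- move=> s s0; have sq0 : 0 <= 2 ^+ p * s ^+ q by rewrite mulr_ge0 ?exprn_ge0.
  rewrite (_ : 2 ^+ p * (s ^+ q * J s) = (2 ^+ p * s ^+ q) * J s); last by rewrite mulrA.
  rewrite EFinM -minJ// -ge0_integralZl//.
  + by apply: eq_integral => t _; congr EFin; rewrite /F !exprMn; ring.
  + apply/measurable_EFinP; apply: measurable_funTS.
    apply: measurable_funM; last exact: measurable_normal_pdf.
    apply: measurable_funM; last exact: measurable_funX.
    by apply: measurable_funX; exact: measurable_minr.
  + move=> t/=; rewrite in_itv/= andbT => t0.
    by rewrite lee_fin !mulr_ge0 ?exprn_ge0 ?normal_pdf_ge0// le_min t0.
- under eq_integral do rewrite -mulrA EFinM.
  rewrite ge0_integralZl//; first by rewrite Jc.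
  + apply/measurable_EFinP; apply: measurable_funTS.
    apply: measurable_funM; last exact: measurable_normal_pdf.
    by apply: measurable_funM; [exact: measurable_funX|exact: continuous_measurable_fun].
  + move=> s/=; rewrite in_itv/= andbT => s0.
    by rewrite lee_fin !mulr_ge0 ?exprn_ge0 ?J0// normal_pdf_ge0.
Qed.

Lemma integral_sign_gap1 : (\int[P]_w (sign_gap (X w) (Y w))%:E =
  ((2 * Num.sqrt 2 - 2) / Num.sqrt pi)%:E)%E.
Proof.
transitivity (\int[P]_w (sign_gap (X w) (Y w) ^+ 1 * `|X w * Y w| ^+ 0)%:E)%E.
  by apply: eq_integral => w _; rewrite expr1 expr0 mulr1.
rewrite (integral_sign_gap (J := fun s => peak - phi s + s * Q s)
  (c := peak - (2 * Num.sqrt pi)^-1))//.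
- congr EFin; rewrite peakE invfM (invfM 2).
  have r2 : Num.sqrt 2 ^+ 2 = 2 :> R by rewrite sqr_sqrtr.
  have -> : (Num.sqrt 2)^-1 = Num.sqrt 2 / 2 :> R.
    by rewrite -[X in _ / X]r2 expr2 invfM mulrA divff ?mul1r// gt_eqF// sqrtr_gt0.
  by move: (Num.sqrt pi)^-1 (Num.sqrt 2) => s r; field.
- by apply: continuous_derivable => s; apply: ex_derive.
- exact: integral_min.
- by under eq_integral do rewrite expr0 mul1r; exact: integral_min_std_pdf.
Qed.

Lemma integral_sign_gap2 : (\int[P]_w (sign_gap (X w) (Y w) ^+ 2)%:E =
  (2 - 4 / pi)%:E)%E.
Proof.
transitivity (\int[P]_w (sign_gap (X w) (Y w) ^+ 2 * `|X w * Y w| ^+ 0)%:E)%E.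
  by apply: eq_integral => w _; rewrite expr0 mulr1.
rewrite (integral_sign_gap (J := fun s => 2^-1 - (s * phi s + Q s) + s ^+ 2 * Q s)
  (c := 4^-1 - (2 * pi)^-1))//.
- by congr EFin; rewrite invfM; move: (pi^-1) => s; field.
- by apply: continuous_derivable => s; apply: ex_derive.
- exact: integral_min_sqr.
- by under eq_integral do rewrite expr0 mul1r; exact: integral_min_sqr_std_pdf.
Qed.

Lemma integral_sign_gap_prod : (\int[P]_w
  (sign_gap (X w) (Y w) * `|X w * Y w|)%:E = (Num.sqrt pi)^-1%:E)%E.
Proof.
transitivity (\int[P]_w (sign_gap (X w) (Y w) ^+ 1 * `|X w * Y w| ^+ 1)%:E)%E.
  by apply: eq_integral => w _; rewrite !expr1.
rewrite (integral_sign_gap (J := fun s => 2^-1 - Q s)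
  (c := (4 * Num.sqrt pi)^-1))//.
- by congr EFin; rewrite invfM; move: (Num.sqrt pi)^-1 => s; field.
- by apply: continuous_derivable => s; apply: ex_derive.
- exact: integral_min_mul.
- by under eq_integral do rewrite expr1; exact: integral_min_mul_std_pdf.
Qed.

(** The signed product has zero mean: |XY| - XY has the same mean as |XY|. *)
Lemma integral_prod_sym : (\int[P]_w (`|X w * Y w| - X w * Y w)%:E = (2 / pi)%:E)%E.
Proof.
pose f (x y : R) := `|x * y| - x * y.
have cf x : continuous (f x).
  move=> y; have cm : continuous (fun y : R => x * y).
    by move=> z; apply: cvgM; [exact: cvg_cst|exact: cvg_id].
  apply: cvgB; last exact: cm.
  apply: (@continuous_comp _ _ _ (fun y => x * y) Num.norm).
    exact: cm.
  exact: norm_continuous.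
have mf : measurable_fun setT (fun z : RT * RT => f z.1 z.2).
  by apply: measurable_funB; [apply: measurableT_comp => //|]; exact: measurable_funM.
have f0 x y : 0 <= f x y by rewrite subr_ge0 ler_norm.
have := @integral_gaussian_flip _ _ _ P X Y gaussianX gaussianY indepXY f mf cf f0.
rewrite (_ : (\int[N]_x _)%E = (\int[N]_x \int[N]_y (2 * `|x * y|)%:E)%E); last first.
  apply: eq_integral => x _; apply: eq_integral => y _; congr EFin.
  by rewrite /f mulrN normrN; ring.
rewrite -(@integral_gaussian_pair _ _ _ P X Y gaussianX gaussianY indepXY
  (fun z => (2 * `|z.1 * z.2|)%:E)); last 2 first.
- apply/measurable_EFinP; apply: measurable_funM => //.
  by apply: measurableT_comp => //; exact: measurable_funM.
- by move=> z; rewrite lee_fin mulr_ge0.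
have -> : (\int[P]_w (2 * `|X w * Y w|)%:E = 2%:E * (2 / pi)%:E)%E.
  under eq_integral do rewrite EFinM.
  rewrite ge0_integralZl//=; first by rewrite integral_abs_prod.
  by apply/measurable_EFinP; apply: measurableT_comp => //; exact: measurable_funM.
set A := (\int[P]_w _)%E => h.
have -> : A = (2^-1%:E * (2%:E * A))%E by rewrite muleA -EFinM mulVf ?mul1e.
by rewrite h -!EFinM mulrA mulVf ?mul1r.
Qed.

End GaussianMoments.

(** * Measurability and pairwise independence *)

Section SchemeMeasurability.
Context (d : measure_display) (T : measurableType d) (R : realType).
Variables beta gamma : R.
Implicit Types (eta : R) (y g u v : T -> R).

Lemma measurable_compC (f : R -> R) y : continuous f ->
  measurable_fun setT y -> measurable_fun setT (f \o y).
Proof.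
move=> cf my; apply: measurableT_comp => //.
exact: continuous_measurable_fun.
Qed.

Let continuous_drift : continuous (drift beta).
Proof. by apply: continuous_derivable => x; rewrite /drift; apply: ex_derive. Qed.

Let measurable_tamed_step eta y g : 0 < eta ->
  measurable_fun setT y -> measurable_fun setT g ->
  measurable_fun setT (fun w => tamed_step beta gamma eta (y w) (g w)).
Proof.
move=> eta0 my mg; rewrite /tamed_step; apply: measurable_funD.
  apply: measurable_funD => //.
  apply: (@measurable_compC
    (fun z => eta * drift beta z / (1 + eta * `|drift beta z|))) => // z.
  have cd : drift beta @ z --> drift beta z by exact: continuous_drift.
  apply: cvgM; first by apply: cvgM; [exact: cvg_cst|exact: cd].
  apply: cvgV.
    by rewrite gt_eqF// ltr_wpDr ?mulr_ge0// ltW.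
  apply: cvgD; first exact: cvg_cst.
  by apply: cvgM; [exact: cvg_cst|apply: cvg_norm; exact: cd].
apply: measurable_funM => //; apply: measurable_funM => //.
exact: measurable_funM.
Qed.

Let measurable_skew_step eta y u v :
  measurable_fun setT y -> measurable_fun setT u -> measurable_fun setT v ->
  measurable_fun setT (fun w => skew_step beta gamma eta (y w) (u w) (v w)).
Proof.
move=> my mu mv; rewrite /skew_step.
have ca : continuous (skew_alpha beta gamma eta).
  by apply: continuous_derivable => z; rewrite /skew_alpha /drift_ratio; apply: ex_derive.
have cV : continuous (fun z => (Num.sqrt (1 + skew_alpha beta gamma eta z ^+ 2))^-1).
  move=> z; apply: cvgV.
    by rewrite gt_eqF// sqrtr_gt0 ltr_wpDr// sqr_ge0.
  apply: (@continuous_comp _ _ _ (fun z => 1 + skew_alpha beta gamma eta z ^+ 2)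
    Num.sqrt); last exact: sqrt_continuous.
  apply: cvgD; first exact: cvg_cst.
  apply: (@continuous_comp _ _ _ (skew_alpha beta gamma eta) (fun z => z ^+ 2)).
    exact: ca.
  exact: exprn_continuous.
have mb : measurable_fun setT (skew_beta beta gamma eta \o y).
  apply: measurable_compC => // z.
  by apply: cvgM; [exact: cvg_cst|exact: cV].
have md : measurable_fun setT (skew_delta beta gamma eta \o y).
  apply: measurable_compC => // z.
  by apply: cvgM; [exact: ca|exact: cV].
apply: measurable_funD => //; apply: measurable_funM.
  by apply: measurable_funM => //; exact: measurable_funM.
apply: measurable_funD; apply: measurable_funM => //.
exact: measurableT_comp.
Qed.

Let measurable_coarse_noise u v : measurable_fun setT u -> measurable_fun setT v ->
  measurable_fun setT (fun w => coarse_noise (u w) (v w)).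
Proof. by move=> mu mv; apply: measurable_funM => //; exact: measurable_funD. Qed.

Lemma measurable_tamed_difference h (x : R) g1 g2 : 0 < h ->
  measurable_fun setT g1 -> measurable_fun setT g2 ->
  measurable_fun setT (fun w => tamed_fine beta gamma h x (g1 w) (g2 w)
                                - tamed_coarse beta gamma h x (g1 w) (g2 w)).
Proof.
move=> h0 m1 m2; have hh : 0 < h / 2 by rewrite divr_gt0.
apply: measurable_funB.
  apply: measurable_tamed_step => //.
  exact: (@measurable_tamed_step _ (cst x)).
apply: (@measurable_tamed_step _ (cst x)) => //.
exact: measurable_coarse_noise.
Qed.

Lemma measurable_skew_difference h (x : R) u1 u2 v1 v2 :
  measurable_fun setT u1 -> measurable_fun setT u2 ->
  measurable_fun setT v1 -> measurable_fun setT v2 ->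
  measurable_fun setT
    (fun w => skew_fine beta gamma h x (u1 w) (u2 w) (v1 w) (v2 w)
              - skew_coarse beta gamma h x (u1 w) (u2 w) (v1 w) (v2 w)).
Proof.
move=> mu1 mu2 mv1 mv2; apply: measurable_funB.
  apply: measurable_skew_step => //.
  exact: (@measurable_skew_step _ (cst x)).
by apply: (@measurable_skew_step _ (cst x)) => //; exact: measurable_coarse_noise.
Qed.

End SchemeMeasurability.

Lemma independent_pair (d : measure_display) (T : measurableType d) (R : realType)
    (P : probability T R) (I : finType) (Z : I -> {RV P >-> R}) (i j : I) :
  mutually_independent Z -> i != j ->
  forall A B : set R, measurable A -> measurable B ->
  (P (Z i @^-1` A `&` Z j @^-1` B) = P (Z i @^-1` A) * P (Z j @^-1` B))%E.
Proof.
move=> indZ ij A B mA mB; pose C k := if k == i then A else B.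
have mC k : k \in [set i; j]%SET -> measurable (C k).
  by move=> _; rewrite /C; case: ifP.
have := indZ [set i; j]%SET C mC.
have Ci : C i = A by rewrite /C eqxx.
have Cj : C j = B by rewrite /C eq_sym (negbTE ij).
rewrite big_setU1 ?inE//= big_set1 Ci Cj => <-; congr (P _).
apply/seteqP; split=> w.
  by move=> [wA wB] k/=; rewrite !inE => /orP[]/eqP ->; rewrite ?Ci ?Cj.
move=> wC; split.
  by have := wC i; rewrite /= !inE eqxx Ci; apply.
by have := wC j; rewrite /= !inE eqxx orbT Cj; apply.
Qed.

(** * Limits of the normalised variances *)

Section LimitVariances.
Context (d : measure_display) (T : measurableType d) (R : realType).
Variable P : probability T R.
Implicit Types Z : {RV P >-> R}.

Lemma gaussian_sqr_Lfun2 Z : standard_gaussian Z ->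
  (fun w => Z w ^+ 2) \in Lfun P 2%:E.
Proof.
move=> gZ; apply: Lfun2_sqr; first exact: measurable_funX.
by under eq_integral do rewrite -exprM; rewrite integral_pow4// ltry.
Qed.

Variables X Y : {RV P >-> R}.
Hypothesis gaussianX : standard_gaussian X.
Hypothesis gaussianY : standard_gaussian Y.
Hypothesis indepXY : forall A B : set R, measurable A -> measurable B ->
  (P (X @^-1` A `&` Y @^-1` B) = P (X @^-1` A) * P (Y @^-1` B))%E.

Let prod w := X w * Y w.
Let absprod w := `|X w * Y w|.
Let gap w := sign_gap (X w) (Y w).

Let mprod : measurable_fun setT prod.
Proof. exact: measurable_funM. Qed.

Let mabsprod : measurable_fun setT absprod.
Proof. exact: measurableT_comp. Qed.

Let mgap : measurable_fun setT gap.
Proof.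
apply: measurable_funB; last by apply: measurableT_comp => //; exact: measurable_funD.
by apply: measurable_funD; exact: measurableT_comp.
Qed.

Let prod2 : prod \in Lfun P 2%:E.
Proof.
by apply: Lfun2_sqr => //; rewrite integral_sqr_prod// ltry.
Qed.

Let absprod2 : absprod \in Lfun P 2%:E.
Proof.
apply: Lfun2_sqr => //; rewrite /absprod.
by under eq_integral do rewrite real_normK ?num_real//; rewrite integral_sqr_prod// ltry.
Qed.

Let gap2 : gap \in Lfun P 2%:E.
Proof. by apply: Lfun2_sqr => //; rewrite integral_sign_gap2// ltry. Qed.

Let sub12 f : f \in Lfun P 2%:E -> f \in Lfun P 1.
Proof. by move=> f2; rewrite Lfun_subset12 ?fin_num_measure. Qed.

Let E_absprod : expectation P absprod = (2 / pi)%:E.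
Proof. by rewrite unlock integral_abs_prod. Qed.

Let E_gap : expectation P gap = ((2 * Num.sqrt 2 - 2) / Num.sqrt pi)%:E.
Proof. by rewrite unlock integral_sign_gap1. Qed.

Let E_prod : expectation P prod = 0.
Proof.
have -> : prod = (absprod \- (absprod \- prod))%R.
  by apply/funext => w /=; ring.
have D1 : (absprod \- prod)%R \in Lfun P 1 by apply: rpredB; apply: sub12.
rewrite expectationB; [|exact: sub12|exact: D1]; rewrite E_absprod.
have -> : expectation P (absprod \- prod)%R = (2 / pi)%:E.
  by rewrite unlock integral_prod_sym.
by rewrite subee.
Qed.

Lemma variance_tamed_limit (a : R) :
  (fun w => a ^+ 2 * (X w * Y w)) \in Lfun P 2%:E /\
  variance P (fun w => a ^+ 2 * (X w * Y w)) = (a ^+ 4)%:E.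
Proof.
have -> : (fun w => a ^+ 2 * (X w * Y w)) = (a ^+ 2 \o* prod)%R.
  by apply/funext => w /=; rewrite mulrC.
split; first by rewrite Lfun_scale// ler1n.
rewrite varianceZ// varianceE// expectation_sqr integral_sqr_prod// E_prod.
by rewrite expe2 mule0 sube0 mule1 -exprM.
Qed.

Lemma variance_skew_limit (a : R) :
  (fun w => a ^+ 2 * `|X w * Y w| - a * (`|X w| + `|Y w| - `|X w + Y w|))
    \in Lfun P 2%:E /\
  variance P (fun w => a ^+ 2 * `|X w * Y w| - a * (`|X w| + `|Y w| - `|X w + Y w|))
    = (a ^+ 4 - a ^+ 2 * advantage a)%:E.
Proof.
have -> : (fun w => a ^+ 2 * `|X w * Y w| - a * (`|X w| + `|Y w| - `|X w + Y w|))
    = ((a ^+ 2 \o* absprod) \- (a \o* gap))%R.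
  by apply/funext => w /=; rewrite (mulrC _ (a ^+ 2)) (mulrC _ a).
have A2 : (a ^+ 2 \o* absprod)%R \in Lfun P 2%:E by rewrite Lfun_scale// ler1n.
have G2 : (a \o* gap)%R \in Lfun P 2%:E by rewrite Lfun_scale// ler1n.
split; first by rewrite rpredB ?lee1n//.
rewrite varianceB// !varianceZ//.
rewrite covarianceZl; [|exact: sub12|exact: sub12|exact: Lfun2_mul_Lfun1].
rewrite covarianceZr; [|exact: sub12|exact: sub12|exact: Lfun2_mul_Lfun1].
rewrite !varianceE// covarianceE; [|exact: sub12|exact: sub12|exact: Lfun2_mul_Lfun1].
rewrite !expectation_sqr E_absprod E_gap.
have -> : (\int[P]_w (absprod w ^+ 2)%:E = 1%:E)%E.
  rewrite /absprod; under eq_integral do rewrite real_normK ?num_real//.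
  exact: integral_sqr_prod.
rewrite integral_sign_gap2//.
have -> : expectation P (absprod * gap)%R = (Num.sqrt pi)^-1%:E.
  rewrite unlock -(integral_sign_gap_prod gaussianX gaussianY indepXY).
  by apply: eq_integral => w _; rewrite mulrC.
rewrite -!EFin_expe -!EFinM -!EFinN -!EFinD; congr EFin.
rewrite /advantage /cross_coef /square_coef pi_powR32.
have s2 : pi = Num.sqrt pi ^+ 2 :> R by rewrite sqr_sqrtr// pi_ge0.
have r2 : Num.sqrt 2 ^+ 2 = 2 :> R by rewrite sqr_sqrtr.
have s0 : Num.sqrt pi != 0 :> R by rewrite gt_eqF// sqrtr_gt0 pi_gt0.
move: s2 r2 s0; move: (Num.sqrt pi) (Num.sqrt 2) => s r.
generalize (pi : R) => p -> r2 s0.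
have sq : (2 * r - 2) ^+ 2 = 12 - 8 * r.
  have -> : (2 * r - 2) ^+ 2 = 4 * r ^+ 2 - 8 * r + 4 by ring.
  by rewrite r2; ring.
by rewrite (expr_div_n (2 * r - 2)) sq; field.
Qed.

End LimitVariances.

Section LimitsOfSchemes.
Context (d : measure_display) (T : measurableType d) (R : realType).
Variable P : probability T R.
Variables beta gamma : R.
Hypothesis beta_gt0 : 0 < beta.
Hypothesis gamma_gt0 : 0 < gamma.

Lemma tamed_variance_cvg (G1 G2 : {RV P >-> R}) h (a := gamma * Num.sqrt (h / 2)) :
  standard_gaussian G1 -> standard_gaussian G2 ->
  (forall A B : set R, measurable A -> measurable B ->
    (P (G1 @^-1` A `&` G2 @^-1` B) = P (G1 @^-1` A) * P (G2 @^-1` B))%E) ->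
  0 < h ->
  tamed_normalised_variance beta gamma P G1 G2 h x @[x --> +oo] --> (a ^+ 4)%:E.
Proof.
move=> g1 g2 ind h0; have [L2 <-] := variance_tamed_limit g1 g2 ind a.
apply: (@variance_rescaled_cvg _ _ _ P (fun x w =>
    tamed_fine beta gamma h x (G1 w) (G2 w)
    - tamed_coarse beta gamma h x (G1 w) (G2 w)) _
  (fun w => (3 + a) * (1 + G1 w ^+ 2 + G2 w ^+ 2))).
- by move=> x; exact: measurable_tamed_difference.
- exact: L2.
- have -> : (fun w => (3 + a) * (1 + G1 w ^+ 2 + G2 w ^+ 2)) =
    ((3 + a) \o* ((cst 1 \+ (fun w => G1 w ^+ 2)) \+ (fun w => G2 w ^+ 2)))%R.
    by apply/funext => w /=; rewrite mulrC.
  by rewrite Lfun_scale ?ler1n// !Lfun2D ?Lfun_cst ?gaussian_sqr_Lfun2.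
- by move=> x w; exact: tamed_difference_linear.
Qed.

Lemma skew_variance_cvg (U1 U2 V1 V2 : {RV P >-> R}) h
    (a := gamma * Num.sqrt (h / 2)) :
  standard_gaussian U1 -> standard_gaussian U2 ->
  standard_gaussian V1 -> standard_gaussian V2 ->
  (forall A B : set R, measurable A -> measurable B ->
    (P (U1 @^-1` A `&` U2 @^-1` B) = P (U1 @^-1` A) * P (U2 @^-1` B))%E) ->
  0 < h ->
  skew_normalised_variance beta gamma P U1 U2 V1 V2 h x @[x --> +oo]
    --> (a ^+ 4 - a ^+ 2 * advantage a)%:E.
Proof.
move=> g1 g2 g3 g4 ind h0; have [L2 <-] := variance_skew_limit g1 g2 ind a.
have [B HB] := skew_difference_linear beta_gt0 gamma_gt0 h0.
apply: (@variance_rescaled_cvg _ _ _ P (fun x w =>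
    skew_fine beta gamma h x (U1 w) (U2 w) (V1 w) (V2 w)
    - skew_coarse beta gamma h x (U1 w) (U2 w) (V1 w) (V2 w)) _
  (fun w => B * (1 + U1 w ^+ 2 + U2 w ^+ 2 + V1 w ^+ 2 + V2 w ^+ 2))).
- by move=> x; exact: measurable_skew_difference.
- exact: L2.
- have -> : (fun w => B * (1 + U1 w ^+ 2 + U2 w ^+ 2 + V1 w ^+ 2 + V2 w ^+ 2)) =
    (B \o* ((((cst 1 \+ (fun w => U1 w ^+ 2)) \+ (fun w => U2 w ^+ 2))
      \+ (fun w => V1 w ^+ 2)) \+ (fun w => V2 w ^+ 2)))%R.
    by apply/funext => w /=; rewrite mulrC.
  by rewrite Lfun_scale ?ler1n// !Lfun2D ?Lfun_cst ?gaussian_sqr_Lfun2.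
- by move=> x w; exact: HB.
Qed.

End LimitsOfSchemes.

Theorem corollary2 (R : realType) (d : measure_display) (T : measurableType d)
    (P : probability T R) (U1 U2 V1 V2 G1 G2 : {RV P >-> R})
    (gaussian : forall i : 'I_6,
        standard_gaussian (tnth [tuple U1; U2; V1; V2; G1; G2] i))
    (indep : mutually_independent (tnth [tuple U1; U2; V1; V2; G1; G2]))
    (beta gamma : R) (beta_gt0 : 0 < beta) (gamma_gt0 : 0 < gamma) :
  (* existence and finiteness of the limits defining Vte and Vsk *)
  (forall h : R, 0 < h ->
     [/\ tamed_normalised_variance beta gamma P G1 G2 h x @[x --> +oo]
           --> Vte beta gamma P G1 G2 h,
         Vte beta gamma P G1 G2 h \is a fin_num,
         skew_normalised_variance beta gamma P U1 U2 V1 V2 h x @[x --> +oo]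
           --> Vsk beta gamma P U1 U2 V1 V2 h
       & Vsk beta gamma P U1 U2 V1 V2 h \is a fin_num]) /\
  (forall h : R, h_star gamma < h ->
     (Vsk beta gamma P U1 U2 V1 V2 h < Vte beta gamma P G1 G2 h)%E) /\
  (forall h : R, 0 < h -> h < h_star gamma ->
     (Vte beta gamma P G1 G2 h < Vsk beta gamma P U1 U2 V1 V2 h)%E) /\
  (* decimal values, rounded to two digits *)
  `|h_star gamma - 82 / 100 / gamma ^+ 2| < 5 / 1000 / gamma ^+ 2 /\
  `|a_star R - 64 / 100| < 5 / 1000.
Proof.
pose i k (lt_k : (k < 6)%N) : 'I_6 := Ordinal lt_k.
have gU1 : standard_gaussian U1 := gaussian (@i 0 isT).
have gU2 : standard_gaussian U2 := gaussian (@i 1 isT).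
have gV1 : standard_gaussian V1 := gaussian (@i 2 isT).
have gV2 : standard_gaussian V2 := gaussian (@i 3 isT).
have gG1 : standard_gaussian G1 := gaussian (@i 4 isT).
have gG2 : standard_gaussian G2 := gaussian (@i 5 isT).
have indU := @independent_pair _ _ _ _ _ _ (@i 0 isT) (@i 1 isT) indep isT.
have indG := @independent_pair _ _ _ _ _ _ (@i 4 isT) (@i 5 isT) indep isT.
pose a h := gamma * Num.sqrt (h / 2).
have a0 h : 0 < h -> 0 < a h by move=> h0; rewrite mulr_gt0// sqrtr_gt0 divr_gt0.
have teC h : 0 < h ->
    tamed_normalised_variance beta gamma P G1 G2 h x @[x --> +oo]
      --> (a h ^+ 4)%:E.
  exact: tamed_variance_cvg.
have skC h : 0 < h ->
    skew_normalised_variance beta gamma P U1 U2 V1 V2 h x @[x --> +oo]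
      --> (a h ^+ 4 - a h ^+ 2 * advantage (a h))%:E.
  exact: skew_variance_cvg.
have teE h : 0 < h -> Vte beta gamma P G1 G2 h = (a h ^+ 4)%:E.
  by move=> h0; apply/cvg_lim => //; exact: teC.
have skE h : 0 < h -> Vsk beta gamma P U1 U2 V1 V2 h =
    (a h ^+ 4 - a h ^+ 2 * advantage (a h))%:E.
  by move=> h0; apply/cvg_lim => //; exact: skC.
have hs0 : 0 < h_star gamma.
  by rewrite /h_star divr_gt0 ?exprn_gt0// mulr_gt0// exprn_gt0// a_star_gt0.
split; [|split; [|split; [|split]]].
- move=> h h0; rewrite teE// skE//.
  by split => //; [exact: teC|exact: skC].
- move=> h hh; have h0 : 0 < h by exact: lt_trans hh.
  rewrite teE// skE// lte_fin ltrBlDr ltrDl pmulr_rgt0 ?exprn_gt0 ?a0//.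
  by rewrite advantage_gt0 ?a0// -h_star_lt.
- move=> h h0 hh; rewrite teE// skE// lte_fin ltrDl oppr_gt0.
  by rewrite pmulr_rlt0 ?exprn_gt0 ?a0// advantage_lt0 ?a0// -h_star_lt.
- exact: h_star_decimal.
- exact: a_star_decimal.
Qed.
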